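(* Let $\mathcal{M}$ be the triangular lattice with $L^2$ sites and periodic boundary conditions, and consider the Hubbard model described in the context on it. Suppose that the electron number $N_e$ satisfies $|\mathcal{M}|\ge N_e\ge|\mathcal{M}|-\tfrac12|\mathcal{M}|^{1/2}$. Then, in the limits $U\uparrow\infty$ and $s\uparrow\infty$, every ground state of the model has total spin $S_{\mathrm{tot}}=S_{\max}=N_e/2$.
   Context: Lattice: $\mathcal{M}$ is the triangular lattice with $L\times L$ sites and periodic boundary conditions in both directions. Its sites are $x=(n_1,n_2)\in(\mathbb{Z}/L\mathbb{Z})^2$, and each site is joined to its six neighbours $x\pm(1,0)$, $x\pm(0,1)$, $x\pm(1,-1)$. The bond set $\mathcal{B}$ contains each nearest-neighbour pair exactly once with an arbitrary orientation, and $\mathcal{E}=\mathcal{B}\cup\{(y,x):(x,y)\in\mathcal{B}\}$; thus the coordination number is $\zeta=6$. For each $(x,y)\in\mathcal{B}$ introduce two additional sites $u(x,y),\bar u(x,y)$; let $\mathcal{O}$ and $\bar{\mathcal{O}}$ be the sets of all $u(x,y)$ and all $\bar u(x,y)$ respectively, and let $\Lambda=\mathcal{M}\cup\mathcal{O}\cup\bar{\mathcal{O}}$. Operators: $c_{z,\sigma}$ ($z\in\Lambda$, $\sigma\in\{\uparrow,\downarrow\}$) are the fermion annihilation operators, $n_{z,\sigma}=c^\dagger_{z,\sigma}c_{z,\sigma}$. Fix $\mu>0$. For $x\in\mathcal{M}$, $a_{x,\sigma}=(1+2\zeta\mu^2)^{-1/2}\{c_{x,\sigma}+\mu\sum_{y:(x,y)\in\mathcal{B}}(c_{u(x,y),\sigma}-c_{\bar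 u(x,y),\sigma})+\mu\sum_{y:(y,x)\in\mathcal{B}}(c_{u(y,x),\sigma}+c_{\bar u(y,x),\sigma})\}$. For $u=u(x,y)$, $b_{u,\sigma}=c_{u,\sigma}-\mu(c_{x,\sigma}+c_{y,\sigma})$; for $\bar u=\bar u(x,y)$, $b_{\bar u,\sigma}=c_{\bar u,\sigma}+\mu(c_{x,\sigma}-c_{y,\sigma})$. Hamiltonian, with $s,t,U>0$: $H=t\sum_{(x,y)\in\mathcal{E},\sigma}a^\dagger_{x,\sigma}a_{y,\sigma}+s\sum_{v\in\mathcal{O}\cup\bar{\mathcal{O}},\sigma}b^\dagger_{v,\sigma}b_{v,\sigma}+U\sum_{z\in\Lambda}n_{z,\uparrow}n_{z,\downarrow}$. It acts on the $N_e$-electron space with $N_e\le|\mathcal{M}|$. Spin: $S^+_z=c^\dagger_{z,\uparrow}c_{z,\downarrow}$, $S^-_z=c^\dagger_{z,\downarrow}c_{z,\uparrow}$, $S^{(3)}_z=\tfrac12(n_{z,\uparrow}-n_{z,\downarrow})$, $S^{(1)}_z=(S^+_z+S^-_z)/2$, $S^{(2)}_z=(S^+_z-S^-_z)/(2i)$. The total spin is $\mathbf{S}_{\mathrm{tot}}=\sum_{z\in\Lambda}\mathbf{S}_z$, with eigenvalues of $(\mathbf{S}_{\mathrm{tot}})^2$ written $S_{\mathrm{tot}}(S_{\mathrm{tot}}+1)$. Ground states in the limits: a fixed state $|\Phi\rangle$ is a finite-energy state if $\lim_{s\uparrow\infty}\lim_{U\uparrow\infty}\langle\Phi|H|\Phi\rangle<\infty$.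 The ground states in the limits $U\uparrow\infty$, $s\uparrow\infty$ are the normalized $N_e$-electron states minimizing this limiting energy. *)

(* Defs.v *)
From HB Require Import structures.
From mathcomp Require Import all_boot all_order all_algebra.
From mathcomp Require Import all_classical all_reals all_analysis.
From mathcomp Require Import complex.
Import numFieldNormedType.Exports.
Import Order.TTheory GRing.Theory Num.Theory.

Set Implicit Arguments.
Unset Strict Implicit.
Unset Printing Implicit Defensive.

Local Open Scope classical_set_scope.
Local Open Scope ring_scope.
Local Open Scope complex_scope.

Section Hubbard.

Variable R : realType.
Local Notation C := R[i].

Variable L : nat.

Definition site := ('I_L * 'I_L)%type.

(* the three "positive" nearest-neighbour directions e_0 = (1,0),
   e_1 = (0,1), e_2 = (1,-1); the six neighbours of x are x +- e_d *)
Definition nbr (d : 'I_3) (x : site) : site :=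
  match val d with
  | 0 => (ordS x.1, x.2)
  | 1 => (x.1, ordS x.2)
  | _ => (ordS x.1, ord_pred x.2)
  end.

(* Unoriented nearest-neighbour pairs: the pair {x, x + e_d} is indexed by
   (d, x); for L >= 3 every nearest-neighbour pair occurs exactly once. *)
Definition bond := ('I_3 * site)%type.

(* An arbitrary orientation of the bonds: if [o b] the bond b = (d, x) is
   (x, x + e_d) in B, otherwise it is (x + e_d, x). *)
Variable o : bond -> bool.

Definition btail (b : bond) : site := if o b then b.2 else nbr b.1 b.2.
Definition bhead (b : bond) : site := if o b then nbr b.1 b.2 else b.2.

(* Lambda = M  u  O  u  Obar : inl x = x, inr (inl b) = u(b),
   inr (inr b) = ubar(b) *)
Definition lsite := (site + (bond + bond))%type.
Definition usite (b : bond) : lsite := inr (inl b).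
Definition ubsite (b : bond) : lsite := inr (inr b).

(* single-particle modes (z, sigma); sigma = true is "up" *)
Definition mode := (lsite * bool)%type.

(* A state is a complex coefficient for each occupation set T of modes,
   with respect to the basis |T> = c^+_{j1} ... c^+_{jk} |0>, where
   j1 < ... < jk in the order given by enum_rank. *)
Definition fock := {ffun {set mode} -> C}.

Definition jw_sign (T : {set mode}) (j : mode) : C :=
  (-1) ^+ #|[set i in T | (enum_rank i < enum_rank j)%N]|.

Definition ann (j : mode) (psi : fock) : fock :=
  [ffun T : {set mode} => if j \in T then 0 else jw_sign T j * psi (j |: T)].

Definition cre (j : mode) (psi : fock) : fock :=
  [ffun T : {set mode} => if j \in T then jw_sign T j * psi (T :\ j) else 0].

Definition num (z : lsite) (s : bool) (psi : fock) : fock :=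
  cre (z, s) (ann (z, s) psi).

Definition lc_ann (w : lsite -> R) (s : bool) (psi : fock) : fock :=
  \sum_(z : lsite) (w z)%:C *: ann (z, s) psi.
Definition lc_cre (w : lsite -> R) (s : bool) (psi : fock) : fock :=
  \sum_(z : lsite) (w z)%:C *: cre (z, s) psi.

Definition inner (phi psi : fock) : C := \sum_(T : {set mode}) (phi T)^* * psi T.

Variable mu : R.

(* coordination number zeta = 6 *)
Definition zeta : R := 6%:R.

Definition a_coef (x : site) (z : lsite) : R :=
  (Num.sqrt (1 + 2 * zeta * mu ^+ 2))^-1 *
  match z with
  | inl y => if y == x then 1 else 0
  | inr (inl b) =>
      (if btail b == x then mu else 0) + (if bhead b == x then mu else 0)
  | inr (inr b) =>
      (if btail b == x then - mu else 0) + (if bhead b == x then mu else 0)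
  end.

Definition bu_coef (b : bond) (z : lsite) : R :=
  (if z == usite b then 1 else 0)
  - mu * (if z == inl (btail b) then 1 else 0)
  - mu * (if z == inl (bhead b) then 1 else 0).

Definition bub_coef (b : bond) (z : lsite) : R :=
  (if z == ubsite b then 1 else 0)
  + mu * (if z == inl (btail b) then 1 else 0)
  - mu * (if z == inl (bhead b) then 1 else 0).

Definition a_ann x := lc_ann (a_coef x).
Definition a_cre x := lc_cre (a_coef x).

(* H = t sum_{(x,y) in E, sigma} a^+_x a_y
     + s sum_{v in O u Obar, sigma} b^+_v b_v
     + U sum_{z in Lambda} n_{z,up} n_{z,down}.
   E = B u reversed(B): each bond contributes both orientations. *)
Definition hamiltonian (t s U : R) (psi : fock) : fock :=
  t%:C *: (\sum_(b : bond) \sum_(sg : bool)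
             (a_cre (btail b) sg (a_ann (bhead b) sg psi)
              + a_cre (bhead b) sg (a_ann (btail b) sg psi)))
  + s%:C *: (\sum_(b : bond) \sum_(sg : bool)
             (lc_cre (bu_coef b) sg (lc_ann (bu_coef b) sg psi)
              + lc_cre (bub_coef b) sg (lc_ann (bub_coef b) sg psi)))
  + U%:C *: (\sum_(z : lsite) num z true (num z false psi)).

Definition Splus (z : lsite) (psi : fock) : fock := cre (z, true) (ann (z, false) psi).
Definition Sminus (z : lsite) (psi : fock) : fock := cre (z, false) (ann (z, true) psi).
Definition S1 (z : lsite) (psi : fock) : fock := 2%:R^-1 *: (Splus z psi + Sminus z psi).
Definition S2 (z : lsite) (psi : fock) : fock :=
  (2%:R * 'i)^-1 *: (Splus z psi - Sminus z psi).
Definition S3 (z : lsite) (psi : fock) : fock :=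
  2%:R^-1 *: (num z true psi - num z false psi).

Definition Stot1 (psi : fock) : fock := \sum_(z : lsite) S1 z psi.
Definition Stot2 (psi : fock) : fock := \sum_(z : lsite) S2 z psi.
Definition Stot3 (psi : fock) : fock := \sum_(z : lsite) S3 z psi.

Definition Stot_sq (psi : fock) : fock :=
  Stot1 (Stot1 psi) + Stot2 (Stot2 psi) + Stot3 (Stot3 psi).

Definition n_electron (Ne : nat) (psi : fock) : Prop :=
  forall T : {set mode}, #|T| != Ne -> psi T = 0.

Definition normalized (psi : fock) : Prop := inner psi psi = 1.

Variable t : R.

(* <Phi|H|Phi> (a real number since H is hermitian; we take its real part) *)
Definition energy (s U : R) (phi : fock) : R :=
  complex.Re (inner phi (hamiltonian t s U phi)).

Definition limit_energy (phi : fock) (e : \bar R) : Prop :=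
  exists g : R -> \bar R,
    (forall s : R, (energy s U phi)%:E @[U --> +oo] --> g s) /\
    (g s @[s --> +oo] --> e).

Definition finite_energy (phi : fock) : Prop :=
  exists e, limit_energy phi e /\ (e < +oo)%E.

Definition ground_state (Ne : nat) (phi : fock) : Prop :=
  n_electron Ne phi /\ normalized phi /\
  exists e : \bar R, limit_energy phi e /\
    forall (psi : fock) (e' : \bar R),
      n_electron Ne psi -> normalized psi -> limit_energy psi e' -> (e <= e')%E.

End Hubbard.

(* Main.v *)
Require Import Defs.
From HB Require Import structures.
From mathcomp Require Import all_boot all_order all_algebra.
From mathcomp Require Import all_classical all_reals all_analysis.
From mathcomp Require Import complex ring lra zify.
Import numFieldNormedType.Exports.
Import Order.TTheory GRing.Theory Num.Theory.

(**
Finite-energy states are those annihilated by every b operator and without double occupancy.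
Such a state is built from the orthonormal modes a_x, and the absence of double occupancy
becomes the vanishing of the singlet pairs a_x,up a_y,down + a_y,up a_x,down for x = y and for
neighbours x, y.  Hence on a configuration of holes whose occupied sites form a connected set
the spin is maximal.

Let X = N/2 (N/2 + 1) - Stot^2, which commutes with the hopping, the constraints and the hole
projections.  For a ground state Phi with hopping energy e, the variational equation tested
on X^2 Phi gives <X Phi, hop X Phi> = e |X Phi|^2.  But X Phi lives on hole configurations
whose occupied sites are disconnected.  With N_h <= L/2 holes, these have at least 4 holes and at
least 5 hole-hole bonds, so at most 6 N_h - 10 hole moves are available and the hopping energy of
X Phi is at least -(6 N_h - 10) |X Phi|^2.  On the other hand, removing from the filled polarized
state N_h plane waves, chosen best among (2p+1)^2 small momenta, yields hopping energy strictly
below -(6 N_h - 10).  Therefore X Phi = 0.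
*)

Set Implicit Arguments.
Unset Strict Implicit.
Unset Printing Implicit Defensive.

Local Open Scope classical_set_scope.
Local Open Scope ring_scope.
Local Open Scope complex_scope.

(** Configurations with disconnected occupied sites are the obstacle: on them the vanishing singlets
    say nothing about the relative spin of two components. They are therefore excluded by energy.
    Since [X] is symmetric and commutes with the hopping, testing with [X^2 Phi] needs only the
    equation satisfied by [Phi] and still yields the exact hopping energy of [X Phi]. The constant
    10 is twice 5: each hole offers six moves, and a bond between two holes blocks one move of each.

    The bound of L/2 on the number n of holes enters twice. Fewer than L holes leave a full row and
    a full column, which separates components on the torus. In addition, n holes in momenta of size
    about sqrt n / L lose about n * (n / L^2) from the ideal total 6 n; this loss is bounded, and
    the explicit constant falls below 10. For positive t a hole prefers momenta near zero, where the
    hopping eigenvalue of the removed mode has its maximum 6. *)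

Section Fock.
Variables (R : realType) (L : nat).
Local Notation C := R[i].
Implicit Types (j k : mode L) (phi psi : fock R L) (T : {set mode L}).

(** * Anticommutation relations in the occupation basis *)

Lemma jw_signU T j k : j \notin T ->
  jw_sign R (j |: T) k = (-1) ^+ (enum_rank j < enum_rank k)%N * jw_sign R T k.
Proof.
move=> jT; rewrite /jw_sign -exprD; f_equal.
case: ltnP => jk.
  have -> : [set i in j |: T | (enum_rank i < enum_rank k)%N]
     = j |: [set i in T | (enum_rank i < enum_rank k)%N].
    by apply/setP => i; rewrite !inE; case: eqVneq => // ->; rewrite jk.
  by rewrite cardsU1 !inE (negbTE jT).
rewrite add0n; apply: eq_card => i; rewrite !inE andb_orl.
case: eqVneq => [->|//]; by rewrite ltnNge jk andbF.
Qed.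

Lemma jw_signD T j k : j \in T ->
  jw_sign R (T :\ j) k = (-1) ^+ (enum_rank j < enum_rank k)%N * jw_sign R T k.
Proof.
move=> jT; rewrite -[in RHS](finset.setD1K jT) jw_signU ?inE ?eqxx //.
by rewrite mulrA -expr2 sqrr_sign mul1r.
Qed.

Lemma jw_sign_sqr T j : jw_sign R T j * jw_sign R T j = 1.
Proof. by rewrite -expr2 sqrr_sign. Qed.

Lemma enum_rank_sign j k : j != k ->
  (-1) ^+ (enum_rank j < enum_rank k)%N = - (-1) ^+ (enum_rank k < enum_rank j)%N :> C.
Proof.
move=> jk; case: ltngtP => [||/ord_inj /enum_rank_inj jk'].
- by [].
- by rewrite expr0 expr1 opprK.
- by rewrite jk' eqxx in jk.
Qed.

Let mulr_swap (a b c d : C) : a * (b * c * d) = c * (b * a * d).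
Proof. by rewrite -!mulrA mulrCA [a * (c * d)]mulrCA [RHS]mulrCA. Qed.

Lemma ann_is_linear j : linear (@ann R L j).
Proof.
move=> c phi psi; apply/ffunP => T; rewrite !ffunE.
by case: ifP => _; [rewrite scaler0 addr0|rewrite mulrDr mulrCA].
Qed.
HB.instance Definition _ j :=
  GRing.isLinear.Build C (fock R L) (fock R L) *:%R (ann j) (ann_is_linear j).

Lemma cre_is_linear j : linear (@cre R L j).
Proof.
move=> c phi psi; apply/ffunP => T; rewrite !ffunE.
by case: ifP => _; [rewrite mulrDr mulrCA|rewrite scaler0 addr0].
Qed.
HB.instance Definition _ j :=
  GRing.isLinear.Build C (fock R L) (fock R L) *:%R (cre j) (cre_is_linear j).

Lemma ann_ann j k psi : ann j (ann k psi) = - ann k (ann j psi).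
Proof.
apply/ffunP => T; rewrite !ffunE !inE.
case: (boolP (j \in T)) => jT; case: (boolP (k \in T)) => kT;
  rewrite ?orbT ?mulr0 ?oppr0 // !orbF.
case: eqVneq => [->|kj]; first by rewrite ?eqxx ?mulr0 ?oppr0.
rewrite !jw_signU // finset.setUCA (enum_rank_sign kj).
by rewrite !(mulNr, mulrN) opprK mulr_swap.
Qed.

Lemma cre_cre j k psi : cre j (cre k psi) = - cre k (cre j psi).
Proof.
apply/ffunP => T; rewrite !ffunE !inE.
case: (boolP (j \in T)) => jT; case: (boolP (k \in T)) => kT;
  rewrite ?andbF ?mulr0 ?oppr0 // !andbT.
case: eqVneq => [->|kj]; first by rewrite ?eqxx ?mulr0 ?oppr0.
rewrite !jw_signD // (enum_rank_sign kj).
have -> : T :\ j :\ k = T :\ k :\ j by apply/setP => i; rewrite !inE andbCA.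
by rewrite !(mulNr, mulrN) opprK mulr_swap.
Qed.

Lemma ann_cre j k psi :
  ann j (cre k psi) = (if j == k then psi else 0) - cre k (ann j psi).
Proof.
apply/ffunP => T; rewrite !ffunE; case: eqVneq => [<-|jk].
  rewrite !inE !eqxx /=; case: ifP => jT; last first.
    by rewrite oppr0 addr0 finset.setU1K ?jT // jw_signU ?jT // ltnn mul1r mulrA jw_sign_sqr mul1r.
  by rewrite jw_signD // ltnn mul1r finset.setD1K // mulrA jw_sign_sqr mul1r subrr.
rewrite !ffunE add0r !inE jk eq_sym (negbTE jk) /=.
case: (boolP (j \in T)) => jT; case: (boolP (k \in T)) => kT;
  rewrite ?mulr0 ?oppr0 //.
have -> : (j |: T) :\ k = j |: T :\ k.
  apply/setP => i; rewrite !inE; case: (eqVneq i j) => [->|]; rewrite ?jk //.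
rewrite jw_signU // jw_signD // (enum_rank_sign jk).
by rewrite !(mulrN, mulNr) mulr_swap.
Qed.

(** The real part is a symmetric, real bilinear, positive definite form, which is all that the
    variational argument uses. *)
Definition ip phi psi : R := complex.Re (inner phi psi).

Lemma inner_cre j phi psi : inner (cre j phi) psi = inner phi (ann j psi).
Proof.
rewrite /inner (bigID (fun T => j \in T)) /= [X in _ + X]big1 ?addr0; last first.
  by move=> T /negbTE jT; rewrite ffunE jT rmorph0 mul0r.
rewrite [RHS](bigID (fun T => j \in T)) /= [X in _ = X + _]big1 ?add0r; last first.
  by move=> T jT; rewrite ffunE jT mulr0.
rewrite (reindex_onto (fun T => j |: T) (fun T => T :\ j)) /=; last first.
  by move=> T jT; rewrite finset.setD1K.
apply: eq_big => [T|T].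
  rewrite finset.setU11 /=; apply/eqP/idP => [<-|]; first by rewrite !inE eqxx.
  by move=> /finset.setU1K.
rewrite finset.setU11 /= => /eqP TE; have jT : j \notin T by rewrite -TE !inE eqxx.
rewrite !ffunE finset.setU11 (negbTE jT) TE jw_signU // ltnn mul1r.
by rewrite rmorphM /= /jw_sign rmorphXn rmorphN1 mulrA [_ * (phi T)^*]mulrC.
Qed.

End Fock.

(** With [A] and [B] the raising and lowering operators, the terms [A A] and [B B] cancel because
    the square of 1/(2i) is -1/4. No commutation relation is used. *)
Lemma spin_components_sqr (R : realType) (V : lmodType R[i])
    (A B D N : {linear V -> V}) (x : V) :
  2%:R^-1 *: (A (2%:R^-1 *: (A x + B x)) + B (2%:R^-1 *: (A x + B x)))
  + (2%:R * 'i)^-1 *: (A ((2%:R * 'i)^-1 *: (A x - B x)) - B ((2%:R * 'i)^-1 *: (A x - B x)))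
  + 2%:R^-1 *: (D (2%:R^-1 *: (D x - N x)) - N (2%:R^-1 *: (D x - N x)))
  = 2%:R^-1 *: (A (B x) + B (A x)) + 4%:R^-1 *: (D (D x) + N (N x) - D (N x) - N (D x)).
Proof.
rewrite !linearZ /= -?scalerN -!scalerDr !scalerA.
have -> : (2%:R * 'i)^-1 * (2%:R * 'i)^-1 = - (4%:R^-1) :> R[i].
  by rewrite -invfM mulrACA -natrM -expr2 sqrCi mulrN1 invrN.
have -> : 2%:R^-1 * 2%:R^-1 = 4%:R^-1 :> R[i] by rewrite -invfM -natrM.
have -> : 2%:R^-1 = 4%:R^-1 * 2%:R :> R[i].
  by rewrite -[4%N]/(2 * 2)%N natrM invfM divfK ?pnatr_eq0.
rewrite scaleNr -scalerBr -scalerA -!scalerDr; congr (_ *: (_ + _)).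
  rewrite !(raddfD A) !(raddfD B) !(raddfN A) !(raddfN B) /=.
  move: (A (A x)) (A (B x)) (B (A x)) (B (B x)) => a b c d.
  rewrite opprB [c - d - _]addrC opprB [_ + (b - a + _)]addrACA [a + b]addrC.
  by rewrite [b + a + _]addrACA [c + d + _]addrACA !subrr !addr0 scaler_nat mulr2n addrACA.
by rewrite (raddfB D) (raddfB N) opprB addrACA addrA.
Qed.

(** * Smeared operators, the real inner product and the spin generators *)

Section Operators.
Variables (R : realType) (L : nat).
Local Notation C := R[i].
Implicit Types (phi psi : fock R L) (f g : lsite L -> C) (s r q : bool).

Lemma fock_scaleE (c : C) psi (T : {set mode L}) : (c *: psi) T = c * psi T.
Proof. by rewrite ffunE. Qed.

Definition An f s psi : fock R L := \sum_z f z *: ann (z, s) psi.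
(** The coefficients are conjugated so that [Cr f] is the adjoint of [An f]. *)
Definition Cr f s psi : fock R L := \sum_z (f z)^* *: cre (z, s) psi.
Definition dotp f g : C := \sum_z (f z)^* * g z.

Lemma An_is_linear f s : linear (An f s).
Proof.
move=> c phi psi; rewrite /An scaler_sumr -big_split; apply: eq_bigr => z _ /=.
by rewrite linearP scalerDr !scalerA mulrC.
Qed.
HB.instance Definition _ f s :=
  GRing.isLinear.Build C (fock R L) (fock R L) *:%R (An f s) (An_is_linear f s).

Lemma Cr_is_linear f s : linear (Cr f s).
Proof.
move=> c phi psi; rewrite /Cr scaler_sumr -big_split; apply: eq_bigr => z _ /=.
by rewrite linearP scalerDr !scalerA mulrC.
Qed.
HB.instance Definition _ f s :=
  GRing.isLinear.Build C (fock R L) (fock R L) *:%R (Cr f s) (Cr_is_linear f s).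

Lemma An_An f s g r psi : An f s (An g r psi) = - An g r (An f s psi).
Proof.
rewrite /An -sumrN; under eq_bigr do rewrite linear_sum scaler_sumr.
under [RHS]eq_bigr do rewrite linear_sum scaler_sumr -sumrN.
rewrite exchange_big; apply: eq_bigr => z _; apply: eq_bigr => y _ /=.
by rewrite !linearZ /= ann_ann !scalerN !scalerA mulrC.
Qed.

Lemma Cr_Cr f s g r psi : Cr f s (Cr g r psi) = - Cr g r (Cr f s psi).
Proof.
rewrite /Cr -sumrN; under eq_bigr do rewrite linear_sum scaler_sumr.
under [RHS]eq_bigr do rewrite linear_sum scaler_sumr -sumrN.
rewrite exchange_big; apply: eq_bigr => z _; apply: eq_bigr => y _ /=.
by rewrite !linearZ /= cre_cre !scalerN !scalerA mulrC.
Qed.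

Lemma An_Cr f s g r psi :
  An f s (Cr g r psi) = (if s == r then dotp g f else 0) *: psi - Cr g r (An f s psi).
Proof.
have -> : (if s == r then dotp g f else 0) *: psi =
    \sum_z \sum_y (f z * (g y)^*) *: (if (z, s) == (y, r) then psi else 0).
  case: eqVneq => [->|sr]; last first.
    rewrite scale0r big1 // => z _; rewrite big1 // => y _.
    by rewrite xpair_eqE (negbTE sr) andbF scaler0.
  rewrite scaler_suml; apply: eq_bigr => z _.
  rewrite (bigD1 z) //= eqxx [X in _ + X]big1 ?addr0 1?mulrC // => y yz.
  by rewrite xpair_eqE eq_sym (negbTE yz) scaler0.
rewrite /An /Cr -sumrN; under eq_bigr do rewrite linear_sum scaler_sumr.
under [X in _ = _ + X]eq_bigr do rewrite linear_sum scaler_sumr -sumrN.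
rewrite [X in _ = _ + X]exchange_big -big_split; apply: eq_bigr => z _.
rewrite -big_split; apply: eq_bigr => y _ /=.
by rewrite !linearZ /= ann_cre !scalerA scalerBr [(g y)^* * _]mulrC scalerN.
Qed.

Lemma conjJM (x y : C) : Num.conj (Num.conj x * y) = x * Num.conj y.
Proof. by rewrite rmorphM; congr (_ * _); exact: conjCK. Qed.

Lemma inner_Cr f s phi psi : inner (Cr f s phi) psi = inner phi (An f s psi).
Proof.
rewrite /Cr /An.
have innersl (F : lsite L -> fock R L) p : inner (\sum_z F z) p = \sum_z inner (F z) p.
  rewrite /inner exchange_big; apply: eq_bigr => T _.
  by rewrite sum_ffunE rmorph_sum mulr_suml.
have innersr (F : lsite L -> fock R L) p : inner p (\sum_z F z) = \sum_z inner p (F z).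
  rewrite /inner exchange_big; apply: eq_bigr => T _.
  by rewrite sum_ffunE mulr_sumr.
rewrite innersl innersr; apply: eq_bigr => z _.
rewrite -[RHS](_ : f z * inner phi (ann (z, s) psi) = _); last first.
  rewrite /inner mulr_sumr; apply: eq_bigr => T _.
  by rewrite fock_scaleE mulrCA.
rewrite -inner_cre /inner mulr_sumr; apply: eq_bigr => T _.
by rewrite fock_scaleE conjJM mulrA.
Qed.

Lemma ip_Cr f s phi psi : ip (Cr f s phi) psi = ip phi (An f s psi).
Proof. by rewrite /ip inner_Cr. Qed.

Lemma ReD (x y : C) : complex.Re (x + y) = complex.Re x + complex.Re y.
Proof. by case: x; case: y. Qed.
Lemma ReJ (x : C) : complex.Re x^* = complex.Re x.
Proof. by case: x. Qed.
Lemma ReM (x : R) (y : C) : complex.Re (x%:C * y) = x * complex.Re y.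
Proof. by case: y => a b /=; rewrite mul0r subr0. Qed.

Lemma ipC phi psi : ip phi psi = ip psi phi.
Proof.
rewrite /ip -ReJ; f_equal; rewrite /inner rmorph_sum; apply: eq_bigr => T _.
by rewrite rmorphM /= conjcK mulrC.
Qed.

Lemma ip_An f s phi psi : ip (An f s phi) psi = ip phi (Cr f s psi).
Proof. by rewrite ipC -ip_Cr ipC. Qed.

Lemma ipDr phi psi psi' : ip phi (psi + psi') = ip phi psi + ip phi psi'.
Proof.
rewrite /ip -ReD; f_equal; rewrite /inner -big_split; apply: eq_bigr => T _ /=.
by rewrite ffunE mulrDr.
Qed.
Lemma ipZr phi (a : R) psi : ip phi (a%:C *: psi) = a * ip phi psi.
Proof.
rewrite /ip -ReM; f_equal; rewrite /inner mulr_sumr; apply: eq_bigr => T _ /=.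
by rewrite fock_scaleE mulrCA.
Qed.
Lemma ipNr phi psi : ip phi (- psi) = - ip phi psi.
Proof. by rewrite -scaleN1r -[X in ip _ (X *: _)](rmorphN1 (real_complex R)) ipZr mulN1r. Qed.
Lemma ipBr phi psi psi' : ip phi (psi - psi') = ip phi psi - ip phi psi'.
Proof. by rewrite ipDr ipNr. Qed.
Lemma ip0r phi : ip phi 0 = 0.
Proof. by rewrite -(subrr 0) ipBr subrr. Qed.
Lemma ipDl phi psi psi' : ip (psi + psi') phi = ip psi phi + ip psi' phi.
Proof. by rewrite ipC ipDr !(ipC phi). Qed.
Lemma ipZl phi (a : R) psi : ip (a%:C *: psi) phi = a * ip psi phi.
Proof. by rewrite ipC ipZr (ipC phi). Qed.
Lemma ipNl phi psi : ip (- psi) phi = - ip psi phi.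
Proof. by rewrite ipC ipNr (ipC phi). Qed.
Lemma ip_sumr (I : finType) (P : pred I) (F : I -> fock R L) phi :
  ip phi (\sum_(i | P i) F i) = \sum_(i | P i) ip phi (F i).
Proof. exact: (big_morph _ (ipDr phi) (ip0r phi)). Qed.
Lemma ip_suml (I : finType) (P : pred I) (F : I -> fock R L) phi :
  ip (\sum_(i | P i) F i) phi = \sum_(i | P i) ip (F i) phi.
Proof. by rewrite ipC ip_sumr; apply: eq_bigr => i _; rewrite ipC. Qed.

Lemma inner_self phi : inner phi phi = (ip phi phi)%:C.
Proof.
rewrite /ip; have : 0 <= inner phi phi.
  by apply: sumr_ge0 => T _; rewrite mulrC mulcJ_ge0.
by move=> h; rewrite RRe_real // ger0_real.
Qed.

Lemma ip_ge0 phi : 0 <= ip phi phi.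
Proof.
by rewrite -ler0c -inner_self; apply: sumr_ge0 => T _; rewrite mulrC mulcJ_ge0.
Qed.

Lemma ip_eq0 phi : ip phi phi = 0 -> phi = 0.
Proof.
move=> h; have : inner phi phi = 0 by rewrite inner_self h.
move/eqP; rewrite /inner psumr_eq0; last by move=> T _; rewrite mulrC mulcJ_ge0.
move=> /allP h'; apply/ffunP => T; rewrite ffunE.
have /eqP/eqP := h' T (mem_index_enum _).
by rewrite mulf_eq0 conjc_eq0 orbb => /eqP.
Qed.

Lemma normalizedP phi : normalized phi <-> ip phi phi = 1.
Proof.
rewrite /normalized inner_self; split => [/(congr1 (@complex.Re R))//|-> //].
Qed.

Lemma n_electron_lin n (a : C) phi psi :
  n_electron n phi -> n_electron n psi -> n_electron n (a *: phi + psi).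
Proof.
by move=> h1 h2 T hT; rewrite ffunE fock_scaleE h1 // h2 // mulr0 addr0.
Qed.
Lemma n_electron0 n : n_electron n (0 : fock R L).
Proof. by move=> T _; rewrite ffunE. Qed.
Lemma n_electronZ n (a : C) phi : n_electron n phi -> n_electron n (a *: phi).
Proof. by move=> h; rewrite -[X in n_electron n X]addr0; apply: n_electron_lin => //; exact: n_electron0. Qed.
Lemma n_electronD n phi psi :
  n_electron n phi -> n_electron n psi -> n_electron n (phi + psi).
Proof. by move=> h; rewrite -[phi]scale1r; apply: n_electron_lin. Qed.
Lemma n_electronB n phi psi :
  n_electron n phi -> n_electron n psi -> n_electron n (phi - psi).
Proof. by move=> h h'; apply: n_electronD => //; rewrite -scaleN1r; apply: n_electronZ. Qed.
Lemma n_electron_sum n (I : finType) (F : I -> fock R L) :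
  (forall i, n_electron n (F i)) -> n_electron n (\sum_i F i).
Proof.
move=> h; apply: (big_ind (@n_electron R L n)) => //; first exact: n_electron0.
exact: n_electronD.
Qed.

Lemma n_electron_cre n j phi : n_electron n phi -> n_electron n.+1 (cre j phi).
Proof.
move=> h T hT; rewrite ffunE; case: ifP => // jT.
by rewrite h ?mulr0 // -(eqn_add2l 1) add1n; rewrite (cardsD1 j) jT in hT.
Qed.
Lemma n_electron_ann n j phi : n_electron n phi -> n_electron n.-1 (ann j phi).
Proof.
move=> h T hT; rewrite ffunE; case: ifP => // jT.
rewrite h ?mulr0 // cardsU1 jT; case: n hT {h} => //= n; by rewrite add1n.
Qed.
Lemma n_electron_cre_ann n j k phi :
  n_electron n phi -> n_electron n (cre j (ann k phi)).
Proof.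
move=> h T hT; rewrite !ffunE !inE; case: ifP => // jT; case: ifP => // kT.
  by rewrite mulr0.
by rewrite h ?mulr0 // cardsU1 !inE kT add1n; rewrite (cardsD1 j) jT in hT.
Qed.

Lemma n_electron_An n f s phi : n_electron n phi -> n_electron n.-1 (An f s phi).
Proof. by move=> h; apply: n_electron_sum => z; apply/n_electronZ/n_electron_ann. Qed.
Lemma n_electron_Cr n f s phi : n_electron n phi -> n_electron n.+1 (Cr f s phi).
Proof. by move=> h; apply: n_electron_sum => z; apply/n_electronZ/n_electron_cre. Qed.

(** The four generators of gl(2) acting on spin: the off-diagonal ones are the total raising and
    lowering operators, the diagonal ones count the electrons of each spin. *)
Definition E s r psi : fock R L := \sum_z cre (z, s) (ann (z, r) psi).

Lemma E_is_linear s r : linear (E s r).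
Proof.
move=> c phi psi; rewrite /E scaler_sumr -big_split; apply: eq_bigr => z _ /=.
by rewrite !linearP.
Qed.
HB.instance Definition _ s r :=
  GRing.isLinear.Build C (fock R L) (fock R L) *:%R (E s r) (E_is_linear s r).

Lemma n_electron_E n s r phi : n_electron n phi -> n_electron n (E s r phi).
Proof. by move=> h; apply: n_electron_sum => z; apply: n_electron_cre_ann. Qed.

Lemma E_ann s r y q psi :
  E s r (ann (y, q) psi) = ann (y, q) (E s r psi) - (if s == q then ann (y, r) psi else 0).
Proof.
have -> : (if s == q then ann (y, r) psi else 0) =
   \sum_z (if (y, q) == (z, s) then ann (z, r) psi else 0).
  rewrite (bigD1 y) //= xpair_eqE eqxx eq_sym [X in _ + X]big1 ?addr0 // => z zy.
  by rewrite xpair_eqE eq_sym (negbTE zy).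
rewrite /E linear_sum -sumrB; apply: eq_bigr => z _.
by rewrite ann_ann linearN /= ann_cre addrAC subrr add0r.
Qed.

Lemma E_cre s r y q psi :
  E s r (cre (y, q) psi) = cre (y, q) (E s r psi) + (if r == q then cre (y, s) psi else 0).
Proof.
have -> : (if r == q then cre (y, s) psi else 0) =
   \sum_z cre (z, s) (if (z, r) == (y, q) then psi else 0).
  rewrite (bigD1 y) //= xpair_eqE eqxx [X in _ + X]big1 ?addr0 => [|z zy].
    by case: eqP => // _; rewrite linear0.
  by rewrite xpair_eqE (negbTE zy) linear0.
rewrite /E linear_sum -big_split; apply: eq_bigr => z _ /=.
by rewrite ann_cre linearB /= cre_cre opprK addrC.
Qed.

Lemma E_An s r f q psi :
  E s r (An f q psi) = An f q (E s r psi) - (if s == q then An f r psi else 0).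
Proof.
rewrite {1 2}/An linear_sum.
under eq_bigr do rewrite linearZ /= E_ann scalerBr.
rewrite sumrB; congr (_ - _); case: eqP => // _.
by rewrite big1 // => z _; rewrite scaler0.
Qed.

Lemma E_Cr s r f q psi :
  E s r (Cr f q psi) = Cr f q (E s r psi) + (if r == q then Cr f s psi else 0).
Proof.
rewrite {1 2}/Cr linear_sum.
under eq_bigr do rewrite linearZ /= E_cre scalerDr.
rewrite big_split; congr (_ + _); case: eqP => // _.
by rewrite big1 // => z _; rewrite scaler0.
Qed.

Lemma ip_cre j phi psi : ip (cre j phi) psi = ip phi (ann j psi).
Proof. by rewrite /ip inner_cre. Qed.
Lemma ip_ann j phi psi : ip (ann j phi) psi = ip phi (cre j psi).
Proof. by rewrite ipC -ip_cre ipC. Qed.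

Lemma ip_E s r phi psi : ip (E s r phi) psi = ip phi (E r s psi).
Proof.
rewrite /E ip_suml ip_sumr; apply: eq_bigr => z _.
by rewrite ip_cre ip_ann.
Qed.

Lemma E_number n psi : n_electron n psi ->
  E true true psi + E false false psi = n%:R *: psi.
Proof.
move=> h; apply/ffunP => T; rewrite ffunE fock_scaleE /E !sum_ffunE -big_split /=.
have numE (z : lsite L) s : cre (z, s) (ann (z, s) psi) T = ((z, s) \in T)%:R * psi T.
  rewrite !ffunE; case: ifP => zT; rewrite ?mul0r // mul1r.
  by rewrite !inE eqxx /= jw_signD // ltnn mul1r finset.setD1K // mulrA jw_sign_sqr mul1r.
under eq_bigr do rewrite !numE -mulrDl.
rewrite -mulr_suml.
case: (eqVneq #|T| n) => [<-|hT]; last by rewrite (h _ hT) !mulr0.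
congr (_ * _); rewrite -sum1_card natr_sum.
rewrite [RHS]big_mkcond /= (eq_bigr (fun p => if (p.1, p.2) \in T then 1 else 0 : C)); last by case.
rewrite -(pair_bigA _ (fun z s => if (z, s) \in T then 1 else 0 : C)) /=.
apply: eq_bigr => z _; rewrite big_bool /=.
by do 2!case: ifP.
Qed.

Lemma Stot_sqE psi : Stot_sq psi =
  2%:R^-1 *: (E true false (E false true psi) + E false true (E true false psi))
  + 4%:R^-1 *: (E true true (E true true psi) + E false false (E false false psi)
     - E true true (E false false psi) - E false false (E true true psi)).
Proof.
rewrite /Stot_sq.
have e1 p : Stot1 p = 2%:R^-1 *: (E true false p + E false true p).
  by rewrite /Stot1 /E -big_split scaler_sumr.
have e2 p : Stot2 p = (2%:R * 'i)^-1 *: (E true false p - E false true p).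
  by rewrite /Stot2 /E -sumrB scaler_sumr.
have e3 p : Stot3 p = 2%:R^-1 *: (E true true p - E false false p).
  by rewrite /Stot3 /E -sumrB scaler_sumr.
by rewrite e1 e2 e3 e1 e2 e3 spin_components_sqr.
Qed.

End Operators.

(** * Spin defect and hopping from the anticommutation relations alone *)

Section CasimirBound.
Variables (R : realType) (V : zmodType) (X Bd : finType) (tail head : Bd -> X).
Variable ip : V -> V -> R.
Hypotheses (ipC : forall u v, ip u v = ip v u)
  (ipDr : forall u v w, ip u (v + w) = ip u v + ip u w)
  (ip_ge0 : forall u, 0 <= ip u u) (ip_eq0 : forall u, ip u u = 0 -> u = 0).
Variables an cr : X -> bool -> {additive V -> V}.
Hypotheses (an_an : forall x s y r v, an x s (an y r v) = - an y r (an x s v))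
  (cr_cr : forall x s y r v, cr x s (cr y r v) = - cr y r (cr x s v))
  (an_cr : forall x s y r v,
     an x s (cr y r v) = (if (x == y) && (s == r) then v else 0) - cr y r (an x s v))
  (ip_cr : forall x s u v, ip (cr x s u) v = ip u (an x s v)).
Variable E : bool -> bool -> {additive V -> V}.
Hypotheses
  (E_an : forall s r x q v,
     E s r (an x q v) = an x q (E s r v) - (if s == q then an x r v else 0))
  (E_cr : forall s r x q v,
     E s r (cr x q v) = cr x q (E s r v) + (if r == q then cr x s v else 0))
  (ip_E : forall s r u v, ip (E s r u) v = ip u (E r s v)).
(** In the model [E] sums over all of Lambda whereas [cr] and [an] belong to the modes [a_x]; [G_EE]
    reconciles the two on vectors without [b] modes. *)
Variables (Ne : nat) (G : V -> Prop).
Hypotheses (GB : forall u v, G u -> G v -> G (u - v))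
  (G_cran : forall x s y r u, G u -> G (cr x s (an y r u)))
  (G_E : forall s r u, G u -> G (E s r u))
  (E_num : forall u, G u -> E true true u + E false false u = u *+ Ne)
  (G_EE : forall s r u, G u -> E s r u = \sum_x cr x s (an x r u)).
Hypothesis tail_head : forall b, tail b != head b.

Implicit Types (u v w : V) (x y z : X) (s r q : bool) (b : Bd).

Let nq v := ip v v.

Lemma form0r u : ip u 0 = 0.
Proof. by apply: (addrI (ip u 0)); rewrite -ipDr !addr0. Qed.
Lemma formNr u v : ip u (- v) = - ip u v.
Proof. by apply: (addrI (ip u v)); rewrite -ipDr !subrr form0r. Qed.
Lemma formBr u v w : ip u (v - w) = ip u v - ip u w.
Proof. by rewrite ipDr formNr. Qed.
Lemma formDl u v w : ip (v + w) u = ip v u + ip w u.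
Proof. by rewrite ipC ipDr !(ipC u). Qed.
Lemma formBl u v w : ip (v - w) u = ip v u - ip w u.
Proof. by rewrite ipC formBr !(ipC u). Qed.
Lemma formMnr u v n : ip u (v *+ n) = ip u v *+ n.
Proof. by elim: n => [|n IH]; rewrite ?mulr0n ?form0r // !mulrS ipDr IH. Qed.
Lemma formMnl u v n : ip (v *+ n) u = ip v u *+ n.
Proof. by rewrite ipC formMnr (ipC u). Qed.
Lemma ip_an x s u v : ip (an x s u) v = ip u (cr x s v).
Proof. by rewrite ipC -ip_cr ipC. Qed.
Lemma form_sumr (I : finType) (F : I -> V) u : ip u (\sum_i F i) = \sum_i ip u (F i).
Proof. exact: (big_morph (ip u) (ipDr u) (form0r u)). Qed.

(* V need not be torsion free a priori; the definite form excludes 2-torsion. *)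
Lemma self_opp0 v : v = - v -> v = 0.
Proof.
move=> h; apply: ip_eq0; have : nq v = - nq v by rewrite {2}/nq -formNr -h.
by rewrite /nq; lra.
Qed.

Lemma an2_0 x s v : an x s (an x s v) = 0.
Proof. exact/self_opp0/an_an. Qed.

Lemma cr2_0 x s v : cr x s (cr x s v) = 0.
Proof. exact/self_opp0/cr_cr. Qed.

(* Annihilates a spin singlet on the sites [x] and [y]; for [x = y] it is twice the
   removal of a double occupancy. *)
Definition singlet x y v := an x true (an y false v) + an y true (an x false v).

Lemma singletC x y v : singlet x y v = singlet y x v.
Proof. by rewrite /singlet addrC. Qed.
Lemma singletB x y u v : singlet x y (u - v) = singlet x y u - singlet x y v.
Proof. by rewrite /singlet !raddfB /= opprD addrACA. Qed.

(** The projection (1 - n_up)(1 - n_down) onto an empty mode at [x]. *)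
Definition hole x v := an x true (cr x true (an x false (cr x false v))).

Lemma hole_is_additive x : zmod_morphism (hole x).
Proof. by move=> u v; rewrite /hole !raddfB. Qed.
HB.instance Definition _ x := GRing.isZmodMorphism.Build V V (hole x) (hole_is_additive x).

Lemma an_cr_id x s v : an x s v = 0 -> an x s (cr x s v) = v.
Proof. by move=> h; rewrite an_cr !eqxx h raddf0 subr0. Qed.

Lemma an_hole x s v : an x s (hole x v) = 0.
Proof.
rewrite /hole; case: s; first exact: an2_0.
by rewrite an_an an_cr eqxx /= an2_0 raddf0 subr0 raddf0 oppr0.
Qed.

Lemma hole_an x y s v : y != x -> hole x (an y s v) = an y s (hole x v).
Proof.
move=> yx; have e q w : cr x q (an y s w) = - an y s (cr x q w).
  by rewrite an_cr (negbTE yx) /= sub0r opprK.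
by rewrite /hole e raddfN /= an_an opprK e raddfN /= an_an opprK.
Qed.

Lemma hole_cr x y s v : y != x -> hole x (cr y s v) = cr y s (hole x v).
Proof.
move=> yx; have e q w : an x q (cr y s w) = - cr y s (an x q w).
  by rewrite an_cr eq_sym (negbTE yx) /= sub0r.
by rewrite /hole cr_cr raddfN /= e opprK cr_cr raddfN /= e opprK.
Qed.

Lemma hole_id x v : (forall s, an x s v = 0) -> hole x v = v.
Proof. by move=> h; rewrite /hole !an_cr_id. Qed.

Lemma hole_idem x v : hole x (hole x v) = hole x v.
Proof. by apply: hole_id => s; apply: an_hole. Qed.

Lemma hole_hole x y v : hole x (hole y v) = hole y (hole x v).
Proof.
case: (eqVneq y x) => [->//|yx].
by rewrite [hole y v]/hole (hole_an _ _ yx) (hole_cr _ _ yx) (hole_an _ _ yx) (hole_cr _ _ yx).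
Qed.

Lemma ip_hole x u v : ip (hole x u) v = ip u (hole x v).
Proof.
rewrite /hole ip_an ip_cr ip_an ip_cr; congr ip.
have e w : cr x false (an x true w) = - an x true (cr x false w).
  by rewrite an_cr eqxx /= sub0r opprK.
have e' w : an x false (cr x true w) = - cr x true (an x false w).
  by rewrite an_cr eqxx /= sub0r.
by rewrite e raddfN /= an_an opprK cr_cr !raddfN /= e' raddfN opprK.
Qed.

(** A singlet pair carries no spin, so spin flips commute with its removal, and a diagonal generator
    only notices the one missing electron of its spin. Hence the vanishing of singlets is spin
    invariant. *)
Lemma E_singlet s r x y v :
  E s r (singlet x y v) = singlet x y (E s r v) - (if s == r then singlet x y v else 0).
Proof.
rewrite /singlet raddfD /= !E_an !raddfB /=.
case: s; case: r; rewrite /= !(raddf0, subr0) addrACA -opprD //.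
  by rewrite [X in _ - (X + _)]an_an addNr subr0.
by rewrite [X in _ - (X + _)]an_an addNr subr0.
Qed.

(** Emptiness is spin invariant. As [hole] treats the two spins in a fixed order, the cases look
    different: for the raising operator each correction vanishes, for the lowering operator the two
    corrections cancel. *)
Lemma E_hole s r x v : E s r (hole x v) = hole x (E s r v).
Proof.
rewrite /hole E_an E_cr E_an E_cr !(raddfB, raddfD) /=.
case: s; case: r; rewrite /= !(raddf0, subr0, addr0).
- by rewrite addrK.
- rewrite [an x false (cr x true _)]an_cr andbF sub0r raddfN /= cr2_0 oppr0 raddf0 addr0.
  by rewrite [an x false (cr x true _)]an_cr andbF sub0r an2_0 raddf0 oppr0 subr0.
- rewrite -addrA -[RHS]addr0; congr (_ + _).
  rewrite [cr x true (an x true _)](_ : _ = cr x false v - an x true (cr x true (cr x false v))).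
    rewrite raddfB /= an2_0 subr0 [an x false (cr x false v)]an_cr !eqxx /=.
    by rewrite raddfB /= cr2_0 subr0 addNr.
  by rewrite [an x true (cr x true _)]an_cr !eqxx /= subKr.
- by rewrite addrK.
Qed.

Definition adj0 x y := (x == y) ||
  [exists b, ((tail b == x) && (head b == y)) || ((tail b == y) && (head b == x))].

(* The finite-energy condition: [G] encodes the kernel of the [b] operators, and the
   vanishing of the singlet pairs encodes the absence of double occupancy on all of Lambda. *)
Definition admissible v := G v /\ forall x y, adj0 x y -> singlet x y v = 0.

Lemma admissibleB u v : admissible u -> admissible v -> admissible (u - v).
Proof.
move=> [Gu Bu] [Gv Bv]; split=> [|x y xy]; first exact: GB.
by rewrite singletB Bu // Bv // subr0.
Qed.
Lemma admissible0 u : admissible u -> admissible 0.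
Proof. by move=> h; rewrite -(subrr u); apply: admissibleB. Qed.
Lemma admissibleD u v : admissible u -> admissible v -> admissible (u + v).
Proof.
move=> hu hv; rewrite -[v]opprK -[- v]sub0r; apply: admissibleB => //.
by apply: admissibleB => //; apply: admissible0 hu.
Qed.
Lemma admissibleMn u n : admissible u -> admissible (u *+ n).
Proof. by move=> h; elim: n => [|n IH]; rewrite ?mulr0n ?mulrS; [apply: admissible0 h|apply: admissibleD]. Qed.

Lemma admissible_E s r v : admissible v -> admissible (E s r v).
Proof.
move=> [Gv Bv]; split=> [|x y xy]; first exact: G_E.
have := E_singlet s r x y v; rewrite Bv // raddf0 if_same subr0 => <- //.
Qed.

Lemma adj0_refl x : adj0 x x. Proof. by rewrite /adj0 eqxx. Qed.

Lemma admissible_double v x : admissible v -> an x true (an x false v) = 0.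
Proof.
move=> [_ /(_ x x (adj0_refl x))]; rewrite /singlet -mulr2n => h.
by apply: self_opp0; apply/eqP; rewrite -addr_eq0 -mulr2n h.
Qed.

(** The product n_up n_down drops out of 1 - (1 - n_up)(1 - n_down). *)
Lemma number_hole v x : an x true (an x false v) = 0 ->
  cr x true (an x true v) + cr x false (an x false v) = v - hole x v.
Proof.
move=> d; rewrite /hole [an x false (cr _ _ _)]an_cr !eqxx /= an_cr !eqxx /= raddfB /=.
rewrite [an x true (cr x false _)]an_cr eqxx /= d raddf0 !subr0.
by rewrite -[_ - _ - _]addrA -opprD subKr addrC.
Qed.

Lemma admissible_hole x v : admissible v -> admissible (hole x v).
Proof.
move=> Cv; have [Gv Bv] := Cv; split=> [|y z yz].
  (* [G] is known to be stable only under operators that conserve the particle number, so the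
     projection is written as v - n_x v. *)
  rewrite -[hole x v]opprK -[- hole x v](addKr v) -number_hole; last exact: admissible_double.
  have G0 : G 0 by rewrite -(subrr v); apply: GB.
  have GN u : G u -> G (- u) by rewrite -[- u]sub0r; apply: GB.
  have GD u w : G u -> G w -> G (u + w) by move=> Gu /GN; rewrite -[w in X in _ -> X]opprK; apply: GB.
  by apply/GN/GD; [apply: GN|apply: GD; apply: G_cran].
case: (eqVneq y x) => [->|yx]; last case: (eqVneq z x) => [->|zx].
- by rewrite /singlet [X in X + _]an_an !an_hole !raddf0 ?oppr0 ?addr0.
- by rewrite /singlet [X in _ + X]an_an !an_hole !raddf0 ?oppr0 ?addr0.
- by rewrite /singlet -!hole_an // -raddfD -/(singlet y z v) Bv // raddf0.
Qed.

(** Four times the total spin squared; the integer coefficients make sense in a mere abelian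
    group. *)
Definition S4 v : V := (E true false (E false true v) + E false true (E true false v)) *+ 2
  + (E true true (E true true v) + E false false (E false false v)
     - E true true (E false false v) - E false false (E true true v)).
(* Four times [N/2 (N/2 + 1) - Stot^2]. *)
Definition spin_defect v : V := v *+ (Ne * (Ne + 2)) - S4 v.

Lemma spin_defect_comm (F : {additive V -> V}) : (forall s r v, F (E s r v) = E s r (F v)) ->
  forall v, spin_defect (F v) = F (spin_defect v).
Proof.
move=> h v; rewrite /spin_defect /S4 (raddfB F) !(raddfMn F) (raddfD F) !(raddfMn F).
by rewrite !(raddfB F) !(raddfD F) !h.
Qed.

Lemma spin_defect_is_additive : zmod_morphism spin_defect.
Proof.
move=> u v; rewrite /spin_defect /S4 !(raddfB (E _ _)) mulrnBl.
have sw (a b c d : V) : a - b + (c - d) = a + c - (b + d) by rewrite opprD addrACA.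
have sw' (a b c d : V) : a - b - (c - d) = a - c - (b - d).
  by rewrite !opprD !opprK addrACA.
have sw3 (a b c d e f : V) : a - b - (c - d) - (e - f) = a - c - e - (b - d - f).
  by rewrite [a - b - _]sw' sw'.
move: (_ *+ (Ne * _)) (_ *+ (Ne * _)) => p p'.
(* Six iterated generators for each of [u] and [v] are generalized; an identity of abelian groups
   remains. *)
do 12 (move: (E _ _ (E _ _ _)) => ?).
by rewrite !sw mulrnBl sw3 sw sw'.
Qed.
HB.instance Definition _ := GRing.isZmodMorphism.Build V V spin_defect spin_defect_is_additive.

Lemma ip_spin_defect u v : ip (spin_defect u) v = ip u (spin_defect v).
Proof.
rewrite /spin_defect /S4 !(formBl, formBr, formDl, ipDr, formMnl, formMnr) !ip_E.
by congr (_ - (_ + _)); rewrite addrAC.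
Qed.

Lemma admissible_spin_defect v : admissible v -> admissible (spin_defect v).
Proof.
move=> h; have hE s r s' r' : admissible (E s r (E s' r' v)) by do 2!apply: admissible_E.
apply: admissibleB; first exact: admissibleMn.
apply: admissibleD; first by apply: admissibleMn; apply: admissibleD.
by do 2!apply: admissibleB => //; apply: admissibleD.
Qed.

(** * Hopping, its spin invariance and its lower bound *)

Definition hopping v : V := \sum_b \sum_(s : bool)
  (cr (tail b) s (an (head b) s v) + cr (head b) s (an (tail b) s v)).

Lemma hopping_is_additive : zmod_morphism hopping.
Proof.
move=> u v; rewrite /hopping -sumrB; apply: eq_bigr => b _; rewrite -sumrB.
by apply: eq_bigr => s _; rewrite !raddfB /= opprD addrACA.
Qed.
HB.instance Definition _ := GRing.isZmodMorphism.Build V V hopping hopping_is_additive.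

Lemma E_pair s r x y v :
  E s r (\sum_(q : bool) cr x q (an y q v)) = \sum_(q : bool) cr x q (an y q (E s r v)).
Proof.
rewrite raddf_sum !big_bool /= !E_cr !E_an !raddfB /= addrACA.
case: s; case: r; rewrite /= !(raddf0, subr0, addr0, oppr0, add0r).
- by rewrite addrAC subrK.
- by rewrite addrAC subrK.
- by rewrite -addrA subrK.
- by rewrite -addrA subrK.
Qed.

Lemma hopping_E s r v : hopping (E s r v) = E s r (hopping v).
Proof.
rewrite /hopping raddf_sum; apply: eq_bigr => b _.
by rewrite !big_split /= raddfD /= !E_pair.
Qed.

Lemma ip_hopping u v : ip u (hopping v) =
  \sum_b \sum_(s : bool) (ip (an (tail b) s u) (an (head b) s v)
                          + ip (an (head b) s u) (an (tail b) s v)).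
Proof.
rewrite form_sumr; apply: eq_bigr => b _; rewrite form_sumr.
by apply: eq_bigr => s _; rewrite ipDr -!ip_an.
Qed.

Lemma ip_hopping_sym u v : ip u (hopping v) = ip v (hopping u).
Proof.
rewrite !ip_hopping; apply: eq_bigr => b _; apply: eq_bigr => s _.
by rewrite addrC (ipC (an (head b) s u)) (ipC (an (tail b) s u)).
Qed.

(** The commutator with a removal at [z] produces removals at the neighbours of [z]; summed against
    a plane wave this becomes an eigenvalue equation. *)
Lemma hopping_an z s v : hopping (an z s v) = an z s (hopping v) -
  \sum_b ((if tail b == z then an (head b) s v else 0)
          + (if head b == z then an (tail b) s v else 0)).
Proof.
have e x y q : cr x q (an y q (an z s v)) = an z s (cr x q (an y q v))
    - (if (x == z) && (q == s) then an y q v else 0).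
  rewrite (an_an y) raddfN /= [an z s (cr _ _ _)]an_cr (eq_sym z) (eq_sym s).
  by case: ifP => _; rewrite ?sub0r ?subr0 // addrAC subrr sub0r.
rewrite /hopping raddf_sum -sumrB; apply: eq_bigr => b _.
rewrite raddf_sum.
under eq_bigr do rewrite !e addrACA -opprD -raddfD.
rewrite sumrB; congr (_ - _); rewrite big_split /= !big_bool.
by congr (_ + _); case: (s); rewrite /= ?andbT ?andbF ?addr0 ?add0r.
Qed.

(* Cauchy-Schwarz bound for the hopping: only moves onto an empty site contribute. *)
Definition kin v : R := \sum_b \sum_(s : bool)
  (nq (hole (head b) (an (tail b) s v)) + nq (hole (tail b) (an (head b) s v))).

Lemma kin0 : kin 0 = 0.
Proof.
by rewrite /kin big1 // => b _; rewrite big1 // => s _; rewrite !raddf0 /nq form0r addr0.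
Qed.

Lemma nqD u v : nq (u + v) = nq u + nq v + ip u v *+ 2.
Proof. by rewrite /nq formDl !ipDr (ipC v u) mulr2n; lra. Qed.

Lemma admissible_hole_an v x s : admissible v -> hole x (an x s v) = an x s v.
Proof.
move=> Cv; apply: hole_id => r; have d := admissible_double x Cv.
by case: r; case: s; rewrite ?an2_0 // an_an d oppr0.
Qed.

(** Without double occupancy a removal leaves its site empty, so both factors of a hopping term can
    be projected onto both ends being empty. Positivity of the norm of their sum then gives 2 <p, q>
    >= - |p|^2 - |q|^2. *)
Lemma hopping_ge v : admissible v -> - kin v <= ip v (hopping v).
Proof.
move=> Cv; rewrite ip_hopping /kin -sumrN; apply: ler_sum => b _; rewrite -sumrN.
apply: ler_sum => s _; set t := tail b; set h := head b.
rewrite (ipC (an h s v)).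
have -> : ip (an t s v) (an h s v) = ip (hole h (an t s v)) (hole t (an h s v)).
  rewrite -{1}(admissible_hole_an t s Cv) -{1}(admissible_hole_an h s Cv).
  by rewrite ip_hole hole_hole -ip_hole.
have := ip_ge0 (hole h (an t s v) + hole t (an h s v)).
by rewrite -/(nq _) nqD mulr2n => ?; lra.
Qed.

Lemma nq_hole_split x v : nq v = nq (hole x v) + nq (v - hole x v).
Proof.
have := nqD (hole x v) (v - hole x v); rewrite addrC subrK => ->.
by rewrite ip_hole raddfB /= hole_idem subrr form0r mul0rn addr0.
Qed.

(** Either the removal is at [x] itself and kills the projected part, or the projection at [x]
    passes through it and the two parts stay orthogonal. *)
Lemma nq_hole_an_split x y z s v : y != z ->
  nq (hole z (an y s v)) = nq (hole z (an y s (hole x v)))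
     + nq (hole z (an y s (v - hole x v))).
Proof.
move=> yz; case: (eqVneq y x) => [->|yx].
  by rewrite raddfB /= an_hole subr0 raddf0 /nq form0r add0r.
by rewrite !raddfB /= -hole_an // !(hole_hole z x) -nq_hole_split.
Qed.

Lemma kin_hole_split x v : kin v = kin (hole x v) + kin (v - hole x v).
Proof.
rewrite /kin -big_split; apply: eq_bigr => b _ /=; rewrite -big_split.
apply: eq_bigr => s _ /=; rewrite addrACA.
by rewrite -!nq_hole_an_split // eq_sym.
Qed.

Lemma hole_E x s r v : hole x (E s r v) = E s r (hole x v).
Proof. by rewrite E_hole. Qed.

Lemma spin_defect_hole x v : spin_defect (hole x v) = hole x (spin_defect v).
Proof. exact: spin_defect_comm (hole_E x) v. Qed.

(* Hole projections commute with [spin_defect] and split both sides orthogonally, so it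
   suffices to treat joint eigenvectors of all of them. *)
Lemma kin_spin_defect_le (c : R) :
  (forall v, admissible v -> (forall x, hole x v = v \/ hole x v = 0) -> kin (spin_defect v) <= c * nq (spin_defect v)) ->
  forall v, admissible v -> kin (spin_defect v) <= c * nq (spin_defect v).
Proof.
move=> base v Cv.
(* The list [l] holds the sites at which [u] is not yet known to be an eigenvector of [hole]; each
   induction step splits [u] at one of them. *)
suff H (l : seq X) u : admissible u -> (forall x, x \notin l -> hole x u = u \/ hole x u = 0) ->
    kin (spin_defect u) <= c * nq (spin_defect u) by apply: (H (enum X)) => // x; rewrite mem_enum.
elim: l u => [|x l IH] u Cu hu; first by apply: base => // x; apply: hu.
rewrite (kin_hole_split x) [X in _ * X](nq_hole_split x) mulrDr -spin_defect_hole -raddfB.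
have Ch := admissible_hole x Cu.
have Cd := admissibleB Cu Ch.
apply: lerD; [apply: (IH _ Ch)|apply: (IH _ Cd)].
  move=> y yl; case: (eqVneq y x) => [->|yx]; first by left; apply: hole_idem.
  have := hu y; rewrite inE (negbTE yx) => /(_ yl); rewrite hole_hole.
  by case=> ->; [left|right; rewrite raddf0].
move=> y yl; case: (eqVneq y x) => [->|yx].
  by right; rewrite raddfB /= hole_idem subrr.
have := hu y; rewrite inE (negbTE yx) => /(_ yl); rewrite raddfB /= hole_hole.
by case=> ->; [left|right; rewrite raddf0 subrr].
Qed.

Lemma spin_defect_eigen_eq0 (e c : R) v : admissible v ->
  (forall w, admissible w -> ip w (hopping v) = e * ip w v) ->
  (forall w, admissible w -> kin (spin_defect w) <= c * nq (spin_defect w)) -> e + c < 0 -> spin_defect v = 0.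
Proof.
move=> Cv he hK ec; apply: ip_eq0; set u := spin_defect v.
have Cu : admissible u by apply: admissible_spin_defect.
have h1 : ip u (hopping u) = e * nq u.
  have -> : hopping u = spin_defect (hopping v) by rewrite (spin_defect_comm hopping_E).
  (* One factor of the defect is moved across the form, so the hypothesis on [v] is applied to the
     admissible vector [spin_defect u]. *)
  by rewrite -ip_spin_defect he; [rewrite ip_spin_defect|apply: admissible_spin_defect].
have h2 := hopping_ge Cu; have h3 := hK v Cv; have h4 := ip_ge0 u.
rewrite -/(nq u) in h4 *; rewrite -/u in h3; apply/eqP; rewrite eq_le h4 andbT.
have : 0 <= (e + c) * nq u by lra.
by rewrite nmulr_rge0.
Qed.

(** When all singlets vanish, the spins of two removed electrons may be exchanged ([swap]). Normal
    ordering then reduces each product of a raising and a lowering operator to N_s + N_s N_s', and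
    the Casimir becomes a polynomial in the total number N_up + N_down. *)
Lemma spin_defect_eq0 v : G v -> (forall x y, singlet x y v = 0) -> spin_defect v = 0.
Proof.
move=> Gv Bv.
have swap x y s : an x (~~ s) (an y s v) = - an y (~~ s) (an x s v).
  have := Bv x y; rewrite /singlet => /eqP; rewrite addr_eq0 => /eqP h.
  by case: s => //=; rewrite an_an -h [in RHS]an_an opprK.
have EE s r q t : E s r (E q t v) =
    \sum_y \sum_x cr y s (an y r (cr x q (an x t v))).
  rewrite (G_EE _ _ (G_E _ _ Gv)) (G_EE q t Gv); apply: eq_bigr => y _.
  by rewrite !raddf_sum.
have key s : E (~~ s) s (E s (~~ s) v) = E (~~ s) (~~ s) v + E (~~ s) (~~ s) (E s s v).
  rewrite !EE (G_EE _ _ Gv) -big_split; apply: eq_bigr => y _ /=.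
  transitivity (\sum_x ((if y == x then cr y (~~ s) (an x (~~ s) v) else 0)
                 + cr y (~~ s) (an y (~~ s) (cr x s (an x s v))))).
    apply: eq_bigr => x _; rewrite !an_cr eqxx andbT.
    have -> : (~~ s == s) = false by case: s.
    rewrite andbF sub0r !raddfB /=; congr (_ + _); first by case: eqP; rewrite ?raddf0.
    rewrite raddfN /=; congr (- _); congr (cr _ _ _); congr (cr _ _ _).
    by rewrite [RHS]swap [LHS]an_an.
  rewrite big_split /=; congr (_ + _).
  by rewrite (bigD1 y) //= eqxx big1 ?addr0 // => x; rewrite eq_sym => /negbTE->.
have comm : E true true (E false false v) = E false false (E true true v).
  rewrite !EE exchange_big; apply: eq_bigr => x _; apply: eq_bigr => y _.
  rewrite !an_cr !andbF !sub0r !raddfN /= cr_cr opprK.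
  by rewrite [an y true _]an_an !raddfN /=.
have k1 := key true; have k2 := key false; rewrite /= in k1 k2.
have num : E true true v + E false false v = v *+ Ne by apply: E_num.
have num2 : E true true (E true true v) + E true true (E false false v)
   + (E false false (E true true v) + E false false (E false false v)) = v *+ (Ne * Ne).
  rewrite -!raddfD num !raddfMn /= -mulrnDl num -mulrnA //.
apply/eqP; rewrite /spin_defect subr_eq0 /S4 k1 k2 comm mulnDr mulrnDr -num2 comm mulrnA -num; apply/eqP.
move: (E true true v) (E false false v) (E true true (E true true v))
  (E false false (E true true v)) (E false false (E false false v)) => p q pp pq qq.
rewrite [p + pq + (q + pq)]addrACA [(p + q + (pq + pq)) *+ 2]mulrnDl -[RHS]addrA [LHS]addrC; congr (_ + _).
rewrite -[_ - pq - pq]addrA -opprD [(pq + pq) *+ 2]mulr2n [pp + qq - _]addrC [RHS]addrA addrK.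
by rewrite [pq + qq]addrC addrACA addrC.
Qed.

(* On an exactly singly occupied site [y], triplet alignment is transitive through [y]. *)
Lemma singlet_trans x y z v : hole y v = 0 -> an y true (an y false v) = 0 ->
  x != y -> y != z -> singlet x y v = 0 -> singlet y z v = 0 -> singlet x z v = 0.
Proof.
move=> hy d xy yz /eqP; rewrite addr_eq0 => /eqP Bxy /eqP; rewrite addr_eq0 => /eqP Byz.
(* Single occupancy of [y] recovers [v] from its removals at [y]. The singlet at [x], [z] commutes
   with both operators at [y], so it is enough that removing at [y] kills it. *)
have nv : v = cr y true (an y true v) + cr y false (an y false v).
  by rewrite number_hole // hy subr0.
have c x' s r w : x' != y -> an x' s (cr y r w) = - cr y r (an x' s w).
  by move=> /negbTE e; rewrite an_cr e sub0r.
have cB r w : singlet x z (cr y r w) = cr y r (singlet x z w).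
  rewrite /singlet raddfD /= (c z) 1?eq_sym // (c x) // raddfN /= raddfN /=.
  by rewrite c // opprK c 1?eq_sym // opprK.
have aB r w : singlet x z (an y r w) = an y r (singlet x z w).
  by rewrite /singlet raddfD /= !(an_an _ _ y) !raddfN /= !(an_an _ _ y) !opprK.
(* A removal of three electrons at [x], [y], [z]: the two known exchanges, across [x], [y] and
   across [y], [z], compose to the exchange across [x], [z]. *)
have vanish r : an y r (singlet x z v) = 0.
  have h1 : an x true (an y false v) = - an y true (an x false v) by [].
  have h2 : an y true (an z false v) = - an z true (an y false v) by [].
  rewrite /singlet raddfD /=; apply/eqP; rewrite addr_eq0; apply/eqP; case: r.
    rewrite an_an h2 raddfN opprK an_an h1 raddfN opprK /=.
    by rewrite [LHS]an_an.
  have h3 : an z false (an y true v) = an z true (an y false v).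
    by rewrite an_an h2 opprK.
  transitivity (an x false (an z true (an y false v))).
    rewrite an_an [an y false (an z false v)]an_an raddfN opprK an_an h1 raddfN opprK /=.
    by rewrite [an y true (an x false v)]an_an raddfN /= an_an opprK h3.
  rewrite [an y false (an z true _)]an_an opprK [an y false (an x false _)]an_an raddfN /=.
  by rewrite [an z true (an x false _)]an_an opprK.
rewrite nv /singlet !raddfD /= addrACA -/(singlet x z (cr y true _)) -/(singlet x z (cr y false _)).
by rewrite !cB !aB !vanish !raddf0 addr0.
Qed.

Lemma adj0C x y : adj0 x y = adj0 y x.
Proof.
by rewrite /adj0 eq_sym; congr (_ || _); apply: eq_existsb => b; rewrite orbC.
Qed.

Definition conn (A : {set X}) := [forall x in A, forall y in A,
  connect (fun x y => [&& adj0 x y, x \in A & y \in A]) x y].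

(** Alignment spreads along a path of singly occupied sites, and a pair that touches an empty site
    is annihilated anyway. So every singlet vanishes, not only the neighbouring ones. *)
Lemma conn_spin_defect_eq0 (A : {set X}) v : admissible v ->
  (forall x, x \in A -> hole x v = 0) -> (forall x, x \notin A -> hole x v = v) ->
  conn A -> spin_defect v = 0.
Proof.
move=> Cv hin hout cA; apply: spin_defect_eq0 => [|x y]; first by case: Cv.
have out (z w : X) : z \notin A -> singlet z w v = 0.
  move=> /hout hz; have e s : an z s v = 0 by rewrite -hz an_hole.
  by rewrite /singlet an_an !e !raddf0 ?oppr0 ?addr0.
case: (boolP (x \in A)) => xA; last exact: out.
case: (boolP (y \in A)) => yA; last by rewrite singletC; apply: out.
move/forallP/(_ x): cA; rewrite xA /= => /forallP/(_ y); rewrite yA /=.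
move=> /connectP[p + ->] {y yA}; elim/last_ind: p => [_|p z IH].
  by apply: (proj2 Cv); apply: adj0_refl.
rewrite rcons_path last_rcons => /andP[/IH h /and3P[adj yA zA]].
set y := last x p in h adj yA *; have Byz := proj2 Cv _ _ adj.
case: (eqVneq x y) => [->//|xy]; case: (eqVneq y z) => [<-//|yz].
by apply: (singlet_trans _ _ xy yz h Byz); [apply: hin|apply: admissible_double].
Qed.

Definition bdry (A : {set X}) : nat := \sum_b
  (((tail b \in A) && (head b \notin A)) + ((head b \in A) && (tail b \notin A))).

(** The occupied end of a boundary bond carries exactly one electron, so its two spin terms add up
    to the full norm; every other bond contributes zero. *)
Lemma kin_bdry (A : {set X}) v : admissible v ->
  (forall x, x \in A -> hole x v = 0) -> (forall x, x \notin A -> hole x v = v) ->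
  kin v = (bdry A)%:R * nq v.
Proof.
move=> Cv hin hout; rewrite /kin /bdry natr_sum mulr_suml; apply: eq_bigr => b _.
have e x y : x != y -> \sum_(s : bool) nq (hole y (an x s v)) =
    ((x \in A) && (y \notin A))%:R * nq v.
  move=> xy; under eq_bigr do rewrite hole_an //.
  case: (boolP (y \in A)) => yA; rewrite ?andbF ?andbT.
    by rewrite hin // big1 ?mul0r // => s _; rewrite raddf0 /nq form0r.
  rewrite hout //.
  have -> : \sum_(s : bool) nq (an x s v) = ip v (v - hole x v).
    rewrite -number_hole; last exact: admissible_double.
    by rewrite big_bool ipDr /nq -!ip_an.
  case: (boolP (x \in A)) => xA; first by rewrite hin // subr0 mul1r.
  by rewrite hout // subrr form0r mul0r.
rewrite big_split /= e ?tail_head // e; last by rewrite eq_sym.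
by rewrite natrD mulrDl.
Qed.

Lemma occupied_card (A : {set X}) v : admissible v -> v != 0 ->
  (forall x, x \in A -> hole x v = 0) -> (forall x, x \notin A -> hole x v = v) ->
  #|A| = Ne.
Proof.
move=> Cv v0 hin hout; have := E_num (proj1 Cv).
rewrite !(G_EE _ _ (proj1 Cv)) -big_split /=.
under eq_bigr do rewrite number_hole ?admissible_double //.
rewrite (bigID (mem A)) /= [X in _ + X]big1 ?addr0 => [|x /hout->]; last by rewrite subrr.
rewrite (eq_bigr (fun=> v)) => [|x /hin->]; last by rewrite subr0.
rewrite sumr_const => /(congr1 (ip v)); rewrite !formMnr -!(mulr_natr (ip v v)).
move=> /mulfI h; apply/eqP; rewrite -(eqr_nat R); apply/eqP; apply: h.
by apply: contra v0 => /eqP/ip_eq0->.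
Qed.

Theorem spin_defect_ground_eq0 (e c : R) v : admissible v ->
  (forall w, admissible w -> ip w (hopping v) = e * ip w v) ->
  (forall A : {set X}, #|A| = Ne -> ~~ conn A -> (bdry A)%:R <= c) ->
  e + c < 0 -> spin_defect v = 0.
Proof.
move=> Cv he hc; apply: (spin_defect_eigen_eq0 Cv he); apply: kin_spin_defect_le => {v Cv he} v Cv hv.
set A := [set x | hole x v == 0]%SET.
(* For v = 0 the set [A] is everything and does not describe an occupation. *)
have [->|v0] := eqVneq v 0.
  by rewrite (raddf0 spin_defect) kin0 /nq form0r mulr0.
have hin x : x \in A -> hole x v = 0 by rewrite inE => /eqP.
have hout x : x \notin A -> hole x v = v.
  by rewrite inE; case: (hv x) => // ->; rewrite eqxx.
have [cA|ncA] := boolP (conn A).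
  by rewrite (conn_spin_defect_eq0 Cv hin hout cA) kin0 /nq form0r mulr0.
rewrite (kin_bdry (admissible_spin_defect Cv) (A := A)).
- apply: ler_wpM2r; first exact: ip_ge0.
  by apply: hc => //; apply: (occupied_card Cv).
- by move=> x /hin h; rewrite -spin_defect_hole h raddf0.
- by move=> x /hout h; rewrite -spin_defect_hole h.
Qed.

End CasimirBound.

(** * Geometry of the triangular torus *)

Section Torus.
Variable L : nat.
Implicit Types (i j k : 'I_L) (x y z : site L) (d : 'I_3).

Lemma val_iter_ordS n i : val (iter n (@ordS L) i) = ((i + n) %% L)%N.
Proof.
elim: n => [|n IH] /=; first by rewrite addn0 modn_small.
by rewrite -addn1 IH modnDml -addnA addn1.
Qed.

(** The successor runs through the whole cycle, so a property that never gets lost along it would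
    hold everywhere. *)
Lemma ordS_exit (P : pred 'I_L) i j : P i -> ~~ P j -> exists k, P k && ~~ P (ordS k).
Proof.
move=> Pi Pj; apply/existsP; apply: contraR Pj => /existsPn h.
have cl n : P (iter n (@ordS L) i).
  elim: n => //= n IH; have := h (iter n (@ordS L) i); by rewrite IH negbK.
(* This many steps lead from [i] to [j] modulo L and avoid the truncated difference of [j] and
   [i]. *)
have := cl (j + (L - i))%N; set k := iter _ _ _; have -> // : k = j.
apply: val_inj; rewrite val_iter_ordS addnCA subnKC ?(ltnW (ltn_ord i)) //.
by rewrite modnDr modn_small.
Qed.

Lemma ord_pred_exit (P : pred 'I_L) i j : P i -> ~~ P j -> exists k, P k && ~~ P (ord_pred k).
Proof.
move=> Pi Pj; have [||k /andP[h1 h2]] := @ordS_exit (predC P) j i => //=.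
  by rewrite negbK.
by exists (ordS k); rewrite ordSK; move: h1 h2 => /= -> /negPn ->.
Qed.

Lemma ordS_neq i : (1 < L)%N -> ordS i != i.
Proof.
move=> L1; apply/eqP => /(congr1 val) /= h; have iL := ltn_ord i.
case: (ltngtP i.+1 L) h => [h|h|h]; [|lia|].
  by rewrite modn_small //; lia.
by rewrite h modnn; lia.
Qed.

Lemma ord_pred_neq i : (1 < L)%N -> ord_pred i != i.
Proof.
move=> L1; apply: contra (ordS_neq (ord_pred i) L1) => /eqP {2}->.
by rewrite ord_predK.
Qed.

Lemma ordS_ord_pred_neq i : (2 < L)%N -> ordS i != ord_pred i.
Proof.
move=> L2; apply/eqP => h; have : ordS (ordS i) = i by rewrite h ord_predK.
move=> /(congr1 val) /= e; have iL := ltn_ord i; move: e.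
case: (ltngtP i.+1 L) => [h1|h1|h1]; [|lia|].
  rewrite [(i.+1 %% L)%N]modn_small //.
  case: (ltngtP i.+2 L) => [h2|h2|h2]; [|lia|].
    by rewrite modn_small //; lia.
  by rewrite h2 modnn; lia.
by rewrite h1 modnn modn_small //; lia.
Qed.

Lemma nbr_inj d : injective (@nbr L d).
Proof.
have SI : injective (@ordS L) := can_inj (@ordSK L).
have PI : injective (@ord_pred L) := can_inj (@ord_predK L).
move=> [a b] [c e] h; have [] := (congr1 fst h, congr1 snd h); move: h => _.
by case: d => [[|[|m]] hm]; rewrite /nbr /= => h h'; congr pair; auto.
Qed.

Variable o : bond L -> bool.
Local Notation tl := (btail o).
Local Notation hd := (bhead o).

Definition d0 : 'I_3 := @Ordinal 3 0 isT.
Definition d1 : 'I_3 := @Ordinal 3 1 isT.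
Definition d2 : 'I_3 := @Ordinal 3 2 isT.

Lemma sum_ends (F : site L -> nat) :
  (\sum_b (F (tl b) + F (hd b)) = 6 * \sum_x F x)%N.
Proof.
transitivity (\sum_(d : 'I_3) \sum_x (F x + F (nbr d x)))%N.
  rewrite pair_big /=; apply: eq_bigr => -[d x] _ /=.
  by rewrite /btail /bhead; case: ifP => //= _; rewrite addnC.
transitivity (\sum_(d < 3) (2 * \sum_x F x))%N.
  apply: eq_bigr => d _; rewrite big_split /=.
  by rewrite -(reindex_inj (F := F) (P := xpredT) (h := nbr d) (@nbr_inj d)) addnn mul2n.
by rewrite sum_nat_const card_ord mulnA.
Qed.

Definition bonds_in (H : {set site L}) := [set b : bond L | (b.2 \in H) && (nbr b.1 b.2 \in H)]%SET.

(** Counting the six bonds at each hole meets a boundary bond once and a bond between holes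
    twice. *)
Lemma bdry_bonds (A : {set site L}) :
  (bdry tl hd A + 2 * #|bonds_in (~: A)| = 6 * #|~: A|)%N.
Proof.
rewrite -[X in (_ = 6 * X)%N]sum1_card [in RHS]big_mkcond /= -sum_ends /bdry.
rewrite -sum1_card [X in (_ + 2 * X)%N]big_mkcond big_distrr -big_split /=.
apply: eq_bigr => -[d x] _ /=; rewrite /btail /bhead !inE /=.
by case: ifP => _ /=; case: (x \in A); case: (nbr d x \in A).
Qed.

Lemma adj0_nbr d x : adj0 tl hd x (nbr d x).
Proof.
rewrite /adj0; apply/orP; right; apply/existsP; exists (d, x).
by rewrite /btail /bhead; case: ifP => _ /=; rewrite !eqxx ?orbT.
Qed.

Lemma tl_neq_hd b : (1 < L)%N -> tl b != hd b.
Proof.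
move=> L1; have h d x : nbr d x != x.
  case: x d => [i j] [[|[|m]] hm]; rewrite /nbr /= xpair_eqE negb_and ordS_neq ?orbT //.
by rewrite /btail /bhead; case: ifP => _; rewrite // eq_sym.
Qed.

Lemma avoid_image (f : site L -> 'I_L) (H : {set site L}) : (#|H| < L)%N ->
  exists i, forall x, f x = i -> x \notin H.
Proof.
move=> h; have /subsetPn[i _ iH] : ~~ ([set: 'I_L]%SET \subset f @: H).
  apply: contraL h => /subset_leq_card; rewrite cardsT card_ord -leqNgt => h.
  exact: leq_trans h (leq_imset_card _ _).
by exists i => x fx; apply: contra iH => xH; rewrite -fx imset_f.
Qed.

Lemma card_ge_uniq (T : finType) (s : seq T) (H : {set T}) :
  uniq s -> all (mem H) s -> (size s <= #|H|)%N.
Proof.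
move=> us /allP h; rewrite cardE; apply: uniq_leq_size => // x xs.
by rewrite mem_enum; apply: h.
Qed.

(* With fewer than [L] holes some row and some column are full, and one component [D] of the
   occupied sites avoids them.  The holes along the top and bottom rows of [D] give the bonds. *)
Lemma disconnected_holes (A : {set site L}) : (2 < L)%N -> (#|~: A| < L)%N ->
  ~~ conn tl hd A -> (4 <= #|~: A|)%N && (5 <= #|bonds_in (~: A)|)%N.
Proof.
move=> L3 HL; have L2 := ltnW L3.
have [r0 fr] := avoid_image snd HL; have [c0 fc] := avoid_image fst HL.
set r := fun x y : site L => [&& adj0 tl hd x y, x \in A & y \in A].
have rs : connect_sym r.
  by apply: sym_connect_sym => x y; rewrite /r adj0C; congr (_ && _); rewrite andbC.
have : forall x y, connect r x (c0, r0) -> connect r y (c0, r0) -> connect r x y.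
  by move=> x y h; rewrite rs; apply: connect_trans.
move=> via; rewrite negb_forall => /existsP[x']; rewrite negb_imply => /andP[x'A].
rewrite negb_forall => /existsP[y']; rewrite negb_imply => /andP[y'A] nc.
(* Of two occupied sites in different components, at most one is joined to the crossing of the full
   row and the full column. *)
have [x xA xn] : exists2 x, x \in A & ~~ connect r x (c0, r0).
  case: (boolP (connect r x' (c0, r0))) => hx; last by exists x'.
  by exists y' => //; apply: contra nc; apply: via.
pose D y := connect r x y.
have DA y : D y -> y \in A.
  case/connectP=> p; case/lastP: p => [_ ->//|p z].
  by rewrite rcons_path last_rcons => /andP[_ /and3P[_ _ zA]] ->.
have Dadj y z : adj0 tl hd y z -> D y -> z \in A -> D z.
  move=> yz Dy zA; have yA := DA y Dy; apply: connect_trans Dy (connect1 _).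
  by rewrite /r yz zA yA.
have hole_of y z : adj0 tl hd y z -> D y -> ~~ D z -> z \in ~: A.
  by move=> yz Dy; rewrite inE; apply: contra => zA; apply: Dadj Dy zA.
have free_row i : (i, r0) \in A by have := fr (i, r0) erefl; rewrite inE negbK.
have free_col j : (c0, j) \in A by have := fc (c0, j) erefl; rewrite inE negbK.
(* If [D] met the full column it would spread along it to the crossing; the full row is treated in
   the same way. *)
have F2 j : ~~ D (c0, j).
  apply/negP => Dj; have [k /andP[h1 /negP]] := ordS_exit (P := fun j => D (c0, j)) Dj xn.
  by apply; apply: Dadj h1 _ => //; apply: (adj0_nbr d1 (c0, k)).
have F1 i : ~~ D (i, r0).
  apply/negP => Di; have [k /andP[h1 /negP]] := ordS_exit (P := fun i => D (i, r0)) Di xn.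
  by apply; apply: Dadj h1 _ => //; apply: (adj0_nbr d0 (k, r0)).
pose PR j := [exists i, D (i, j)].
have PRx : PR x.2 by apply/existsP; exists x.1; rewrite -surjective_pairing; apply: connect0.
have PR0 : ~~ PR r0 by apply/existsPn.
(* Row [j] meets [D] but its successor does not; row [jb] meets [D] but its predecessor does not. In
   both rows the ends of [D] are then located by going right and left. *)
have [j /andP[PRj nPRj]] := ordS_exit PRx PR0.
have [jb /andP[PRb nPRb]] := ord_pred_exit PRx PR0.
have Drow i k : ~~ PR k -> ~~ D (i, k) by move=> /existsPn.
have [i Di] := existsP PRj; have [k Dk] := existsP PRb.
have [iR /andP[DiR nDiR]] := ordS_exit (P := fun i => D (i, j)) Di (F2 j).
have [iL /andP[DiL nDiL]] := ord_pred_exit (P := fun i => D (i, j)) Di (F2 j).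
have [kR /andP[DkR nDkR]] := ordS_exit (P := fun i => D (i, jb)) Dk (F2 jb).
have [kL /andP[DkL nDkL]] := ord_pred_exit (P := fun i => D (i, jb)) Dk (F2 jb).
have a0 a b : adj0 tl hd (a, b) (ordS a, b) by apply: (adj0_nbr d0 (a, b)).
have a1 a b : adj0 tl hd (a, b) (a, ordS b) by apply: (adj0_nbr d1 (a, b)).
have a2 a b : adj0 tl hd (a, b) (ordS a, ord_pred b) by apply: (adj0_nbr d2 (a, b)).
have a0' a b : adj0 tl hd (a, b) (ord_pred a, b).
  by have := a0 (ord_pred a) b; rewrite ord_predK adj0C.
have a1' a b : adj0 tl hd (a, b) (a, ord_pred b).
  by have := a1 a (ord_pred b); rewrite ord_predK adj0C.
have a2' a b : adj0 tl hd (a, b) (ord_pred a, ordS b).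
  by have := a2 (ord_pred a) (ordS b); rewrite ord_predK ordSK adj0C.
have h1 : (iR, ordS j) \in ~: A := hole_of _ _ (a1 _ _) DiR (Drow _ _ nPRj).
have h2 : (ord_pred iR, ordS j) \in ~: A := hole_of _ _ (a2' _ _) DiR (Drow _ _ nPRj).
have h3 : (ordS iR, j) \in ~: A := hole_of _ _ (a0 _ _) DiR nDiR.
have h4 : (ord_pred iL, j) \in ~: A := hole_of _ _ (a0' _ _) DiL nDiL.
have h5 : (ord_pred iL, ordS j) \in ~: A := hole_of _ _ (a2' _ _) DiL (Drow _ _ nPRj).
have g1 : (ordS kR, jb) \in ~: A := hole_of _ _ (a0 _ _) DkR nDkR.
have g2 : (ordS kR, ord_pred jb) \in ~: A := hole_of _ _ (a2 _ _) DkR (Drow _ _ nPRb).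
have g3 : (ord_pred kL, jb) \in ~: A := hole_of _ _ (a0' _ _) DkL nDkL.
have g4 : (kL, ord_pred jb) \in ~: A := hole_of _ _ (a1' _ _) DkL (Drow _ _ nPRb).
have n1 : j != ord_pred jb by apply: contraNneq nPRb => <-.
have n2 : ordS j != jb by apply: contraNneq nPRj => ->.
have n3 : ordS j != j by apply: ordS_neq.
apply/andP; split.
  (* Three holes lie in rows [ordS j] and [j]. The fourth is taken in row [jb], or one row below it
     when [jb] coincides with [j]; there 2 < L separates it from row [ordS j]. *)
  have [jjb|jjb] := eqVneq j jb.
    apply: (@card_ge_uniq _ [:: (iR, ordS j); (ord_pred iR, ordS j); (ordS iR, j); (ordS kR, ord_pred jb)]).
      rewrite /= !inE !xpair_eqE !negb_or !negb_and n1 n3 !orbT /= andbT.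
      by rewrite eq_sym ord_pred_neq //= -jjb ordS_ord_pred_neq // !orbT.
    by rewrite /= h1 h2 h3 g2.
  apply: (@card_ge_uniq _ [:: (iR, ordS j); (ord_pred iR, ordS j); (ordS iR, j); (ordS kR, jb)]).
    rewrite /= !inE !xpair_eqE !negb_or !negb_and n2 n3 jjb !orbT /= andbT.
    by rewrite eq_sym ord_pred_neq.
  by rewrite /= h1 h2 h3 g1.
(* One horizontal bond above [D], and a bond of each other direction at both the upper and the lower
   edge. Two bonds of equal direction start in different rows, by [n1] and [n2]. *)
apply: (@card_ge_uniq _ [:: (d0, (ord_pred iR, ordS j)); (d1, (ord_pred iL, j));
  (d1, (ordS kR, ord_pred jb)); (d2, (iR, ordS j)); (d2, (ord_pred kL, jb))]).
  by rewrite /= !inE !xpair_eqE /= !negb_or !negb_and n1 n2 !orbT.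
rewrite /= !inE /nbr /= !ord_predK !ordSK.
by move: h1 h2 h3 h4 h5 g1 g2 g3 g4; rewrite !inE => -> -> -> -> -> -> -> -> ->.
Qed.

End Torus.

(** * Trigonometric estimates and roots of unity *)

Section Trigonometry.
Variable R : realType.
Local Notation C := R[i].
Implicit Types x y : R.

Lemma sin_ge0_le x : 0 <= x -> sin x <= x.
Proof.
move=> x0; have [y _] : exists2 c, c \in `[0, x] & sin x - sin 0 = cos c * (x - 0).
  by apply: MVT_segment => //; apply: continuous_subspaceT; apply: continuous_sin.
by rewrite sin0 !subr0 => ->; rewrite ler_piMl // cos_le1.
Qed.

Lemma sin_sqr_le x : sin x ^+ 2 <= x ^+ 2.
Proof.
wlog x0 : x / 0 <= x.
  move=> h; case: (leP 0 x) => x0; first exact: h.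
  by rewrite -[sin x ^+ 2]sqrrN -sinN -[x ^+ 2]sqrrN; apply: h; lra.
have := sin_ge0_le x0; have := sin_geN1 x; have := sin_le1 x => h1 h2 h3.
have [s0|s0] := leP 0 (sin x); first nra.
have [x1|x1] := leP x 1; last nra.
have : 0 <= sin x by apply: sin_ge0_pi; rewrite x0 /=; have := pi_ge2 R; lra.
lra.
Qed.

Lemma one_sub_cos_le x : 2 * (1 - cos x) <= x ^+ 2.
Proof.
have -> : x = x / 2 + x / 2 by lra.
by rewrite cosD; have := cos2Dsin2 (x / 2); have := sin_sqr_le (x / 2); nra.
Qed.

(** The derivative of tan is cos^-2, hence at least 1. *)
Lemma tan_ge x : 0 <= x < pi / 2 -> x <= tan x.
Proof.
move=> /andP[x0 xpi]; have pi0 := pi_gt0 R.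
have cpos c : c \in `[0, x] -> 0 < cos c.
  by rewrite in_itv /= => /andP[c0 cx]; apply: cos_gt0_pihalf; lra.
have [||c cx] := @MVT_segment R tan (fun c => (cos c) ^- 2) 0 x x0.
- move=> c /subset_itv_oo_cc cx; apply: is_derive_tan.
  by rewrite gt_eqF // cpos.
- apply: derivable_within_continuous => c cx; apply: derivable_tan.
  by rewrite gt_eqF // cpos.
rewrite tan0 !subr0 => ->; rewrite ler_peMl // invf_ge1 ?exprn_gt0 ?cpos //.
Qed.

(* From [x <= tan x] at [pi / 8], where [tan] is [sqrt 2 - 1]. *)
Lemma pi_sqr_le12 : (pi : R) ^+ 2 <= 12.
Proof.
have p0 := pi_gt0 R; have p2 := pi_ge2 R; set t := tan (pi / 8 : R).
have c0 : 0 < cos (pi / 8 : R) by apply: cos_gt0_pihalf; lra.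
have t_ge : pi / 8 <= t by apply: tan_ge; lra.
have e : tan ((pi / 8 : R) *+ 2) = 1.
  have -> : (pi / 8 : R) *+ 2 = pi / 4 by rewrite mulr2n; lra.
  exact: tan_piquarter.
rewrite tan_mulr2n ?gt_eqF // -/t in e.
have t1 : 1 - t ^+ 2 != 0.
  by apply/eqP => h; move: e; rewrite h invr0 mulr0 => /eqP; rewrite eq_sym oner_eq0.
have e2 : t *+ 2 = 1 - t ^+ 2.
  by move/(congr1 ( *%R^~ (1 - t ^+ 2))): e; rewrite divfK // mul1r.
rewrite mulr2n in e2; rewrite leNgt; apply/negP => h.
(* For pi above 3.4, t >= pi / 8 would give 2 t + t^2 > 1, against [e2]. *)
have h1 : 34 / 10 < pi :> R by nra.
nra.
Qed.

Definition expi x : C := cos x +i* sin x.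

Lemma expiD x y : expi (x + y) = expi x * expi y.
Proof. by rewrite /expi cosD sinD; apply/eqP; rewrite eq_complex /= eqxx /= addrC mulrC [sin x * _]mulrC addrC. Qed.
Lemma expi0 : expi 0 = 1.
Proof. by rewrite /expi cos0 sin0. Qed.
Lemma expiMn x n : expi (x *+ n) = expi x ^+ n.
Proof. by elim: n => [|n IH]; rewrite ?mulr0n ?expi0 // mulrS exprS expiD IH. Qed.
Lemma expi2pi : expi (pi *+ 2) = 1.
Proof. by rewrite /expi cos2pi sin2pi. Qed.
Lemma expiJ x : Num.conj (expi x) = expi (- x).
Proof. by rewrite /expi cosN sinN. Qed.
Lemma expiN x : expi (- x) = (expi x)^-1.
Proof.
have h : expi (- x) * expi x = 1 by rewrite -expiD addNr expi0.
have n0 : expi x != 0 by apply: contra_eq_neq h => ->; rewrite mulr0 eq_sym oner_eq0.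
by rewrite -[RHS]mul1r -h mulfK.
Qed.
Lemma expi_neq0 x : expi x != 0.
Proof. by rewrite -invr_eq0 -expiN; apply/eqP => h; have := expiD x (- x); rewrite subrr expi0 h mulr0 => /eqP; rewrite oner_eq0. Qed.
Lemma expi_add_inv x : expi x + (expi x)^-1 = (2 * cos x)%:C.
Proof.
rewrite -expiN /expi cosN sinN; apply/eqP; rewrite eq_complex /= subrr eqxx andbT.
by apply/eqP; lra.
Qed.

Lemma expi_neq1 x : 0 < x < pi *+ 2 -> expi x != 1.
Proof.
rewrite mulr2n => /andP[x0 xpi]; rewrite eq_complex /= negb_and; apply/orP; left.
have s0 : 0 < sin (x / 2) by apply: sin_gt0_pi; lra.
have -> : x = x / 2 + x / 2 by lra.
rewrite cosD; apply/eqP => h; have := cos2Dsin2 (x / 2).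
have : 0 < sin (x / 2) * sin (x / 2) by apply: mulr_gt0.
nra.
Qed.

Lemma expi_prim_root n : (0 < n)%N -> n.-primitive_root (expi (pi *+ 2 / n%:R)).
Proof.
move=> n0; have nR : 0 < n%:R :> R by rewrite ltr0n.
have u : expi (pi *+ 2 / n%:R) ^+ n = 1.
  by rewrite -expiMn -[X in expi X]mulr_natr divfK ?gt_eqF // expi2pi.
apply/andP; split=> //; apply/forallP => i; rewrite unity_rootE.
apply/eqP; case: (eqVneq i.+1 n) => [->|ni]; first by rewrite u eqxx.
apply/negbTE; rewrite -expiMn; apply: expi_neq1.
have iR : i.+1%:R < n%:R :> R by rewrite ltr_nat ltn_neqAle ni ltn_ord.
have pi0 : 0 < pi *+ 2 :> R by rewrite pmulrn_lgt0 // pi_gt0.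
rewrite -[_ *+ i.+1]mulr_natr; apply/andP; split.
  by rewrite !mulr_gt0 ?invr_gt0 // ltr0n.
by rewrite mulrAC ltr_pdivrMr // ltr_pM2l.
Qed.

End Trigonometry.

(** * Subsets with at most average sum *)

Section AverageSubset.
Variables (R : realType) (I : finType) (f : I -> R).

(* Repeatedly discarding a maximal element keeps the average from increasing. *)
Lemma average_subset n : (n <= #|I|)%N ->
  exists2 S : {set I}, #|S| = n &
    #|I|%:R * \sum_(i in S) f i <= n%:R * \sum_i f i.
Proof.
move=> nI; have [k ->] : exists k, n = (#|I| - k)%N by exists (#|I| - n)%N; rewrite subKn.
elim: k => [|k [S cS hS]] {n nI}.
  exists [set: I]%SET; rewrite ?cardsT ?subn0 //.
  by rewrite (eq_bigl xpredT) // => i; rewrite inE.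
case: (posnP (#|I| - k)) => [Ik|Ik].
  have e : (#|I| - k.+1 = #|I| - k)%N by rewrite subnS Ik.
  by exists S; rewrite e.
have /card_gt0P[i0 i0S] : (0 < #|S|)%N by rewrite cS.
pose i := [arg max_(i > i0 in S) f i]%O.
have [iS imax] : i \in S /\ forall j, j \in S -> f j <= f i.
  by rewrite /i; case: arg_maxP => // j jS jm; split.
have cS' : (#|S :\ i|.+1 = #|I| - k)%N by rewrite -cS (cardsD1 i S) iS add1n.
exists (S :\ i)%SET; first by rewrite subnS -cS'.
have s1 : \sum_(j in S) f j = f i + \sum_(j in (S :\ i)%SET) f j.
  by rewrite (big_setD1 i).
have s2 : \sum_(j in (S :\ i)%SET) f j <= #|S :\ i|%:R * f i.
  rewrite mulr_natl -sumr_const; apply: ler_sum => j; rewrite !inE => /andP[_]; exact: imax.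
rewrite subnS -cS' /=; move: hS s2; rewrite -cS' s1 -natr1.
move: (\sum_(j in (S :\ i)%SET) f j) (f i) (#|S :\ i|%:R : R) (ler0n R #|S :\ i|) => a b m m0.
move: (#|I|%:R : R) (ler0n R #|I|) (\sum_j f j) => q q0 W h1 h2.
have h3 : (m + 1) * (q * a) <= (m + 1) * (m * W) by nra.
by rewrite -(ler_pM2l (_ : 0 < m + 1)) //; lra.
Qed.

End AverageSubset.

(** The effect on a plane wave of a step along (1,-1), which gains one phase and loses the other. *)
Lemma mulr_shift (F : fieldType) (a b c d v : F) : v != 0 ->
  a * (b * c * d) = b / v * (a * (c * (v * d))).
Proof. by move=> v0; field. Qed.

(** * Plane waves and the total energy of a block of small momenta *)

Section PlaneWaves.
Variables (R : realType) (L : nat).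
Local Notation C := R[i].
Hypothesis L0 : (0 < L)%N.

(* An eigenvector of all lattice translations; [eps] is its hopping eigenvalue. *)
Definition bloch (f : site L -> C) (lam : 'I_3 -> C) (eps : R) : Prop :=
  [/\ forall d x, f (nbr d x) = lam d * f x, forall d, lam d != 0
    & \sum_d (lam d + (lam d)^-1) = eps%:C].

(** The offset centres the momenta: as [k] runs over 0, ..., 2p, they run symmetrically around
    zero. *)
Definition angle (p k : nat) : R := pi *+ 2 / L%:R * (k%:R - p%:R).
Definition wave (p : nat) (k : 'I_p.*2.+1 * 'I_p.*2.+1) (x : site L) : C :=
  (L%:R)^-1 * (expi (angle p k.1) ^+ x.1 * expi (angle p k.2) ^+ x.2).
Definition wave_energy p (k : 'I_p.*2.+1 * 'I_p.*2.+1) : R :=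
  2 * (cos (angle p k.1) + cos (angle p k.2) + cos (angle p k.1 - angle p k.2)).

Let LR : L%:R != 0 :> R.
Proof. by rewrite pnatr_eq0 -lt0n. Qed.
Let LC : L%:R != 0 :> C.
Proof. by rewrite pnatr_eq0 -lt0n. Qed.

(** Adding a full turn makes the possibly negative multiple k - p a natural exponent. *)
Lemma expi_angle p k : (p <= L)%N ->
  expi (angle p k) = expi (pi *+ 2 / L%:R) ^+ (k + (L - p)).
Proof.
move=> pL; rewrite -expiMn -[_ *+ (k + _)]mulr_natr natrD natrB //.
have -> : pi *+ 2 / L%:R * (k%:R + (L%:R - p%:R)) = angle p k + pi *+ 2.
  by rewrite /angle; field.
by rewrite expiD expi2pi mulr1.
Qed.

Lemma expi_angleX p k : (p <= L)%N -> expi (angle p k) ^+ L = 1.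
Proof.
by move=> pL; rewrite expi_angle // exprAC (prim_expr_order (expi_prim_root R L0)) expr1n.
Qed.

Lemma expi_angle_eq p (k l : 'I_p.*2.+1) : (p.*2 < L)%N ->
  (expi (angle p k) == expi (angle p l)) = (k == l).
Proof.
move=> pL; have pL' : (p <= L)%N by lia.
rewrite !expi_angle // (eq_prim_root_expr (expi_prim_root R L0)) eqn_modDr.
by rewrite !modn_small // (leq_trans (ltn_ord _)).
Qed.

Lemma wave_bloch p k : (p.*2 < L)%N -> exists lam, bloch (@wave p k) lam (wave_energy k).
Proof.
move=> pL; have pL' : (p <= L)%N by lia.
pose u := expi (angle p k.1); pose v := expi (angle p k.2).
exists (fun d => match val d with 0 => u | 1 => v | _ => u * v^-1 end).
have step w i : w ^+ L = 1 -> w ^+ (ordS i : 'I_L) = w * w ^+ i :> C.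
  by move=> h; rewrite /= expr_mod // exprS.
split.
- move=> [[|[|m]] hm] [i j]; rewrite /nbr /wave /= -/u -/v.
  + by rewrite expr_mod ?expi_angleX // exprS -!mulrA mulrCA.
  + by rewrite expr_mod ?expi_angleX // exprS !mulrA [v * _]mulrC -!mulrA [v * _]mulrCA.
  have e : v ^+ j = v * v ^+ (ord_pred j).
    by rewrite -step ?ord_predK ?expi_angleX.
  rewrite expr_mod ?expi_angleX // exprS e.
  by apply: mulr_shift; apply: expi_neq0.
- by move=> [[|[|m]] hm] /=; rewrite ?mulf_neq0 ?invr_neq0 ?expi_neq0.
have uv : u / v = expi (angle p k.1 - angle p k.2) by rewrite expiD expiN.
rewrite !big_ord_recl big_ord0 /= addr0 uv /u /v !expi_add_inv -!rmorphD /=.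
by rewrite /wave_energy -!mulrDr addrA.
Qed.

Lemma wave_orthonormal p (k l : 'I_p.*2.+1 * 'I_p.*2.+1) : (p.*2 < L)%N ->
  \sum_x Num.conj (wave k x) * wave l x = (k == l)%:R.
Proof.
move=> pL; have pL' : (p <= L)%N by lia.
pose g (a b : 'I_p.*2.+1) : C := Num.conj (expi (angle p a)) * expi (angle p b).
have gs a b : \sum_(i < L) g a b ^+ i = (a == b)%:R * L%:R.
  have gL : g a b ^+ L = 1.
    by rewrite exprMn -rmorphXn /= !expi_angleX // rmorph1 mul1r.
  have g1 : (g a b == 1) = (a == b).
    rewrite /g expiJ expiN -(inj_eq (mulfI (expi_neq0 (angle p a)))).
    by rewrite mulVKf ?expi_neq0 // mulr1 eq_sym expi_angle_eq.
  case: eqVneq => ab.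
    have -> : g a b = 1 by apply/eqP; rewrite g1 ab.
    rewrite (eq_bigr (fun=> 1)); last by move=> i _; rewrite expr1n.
    by rewrite sumr_const card_ord mul1r.
  have := subrX1 (g a b) L; rewrite gL subrr => /esym/eqP.
  by rewrite mulf_eq0 subr_eq0 g1 (negbTE ab) mul0r => /eqP.
transitivity ((L%:R)^-1 ^+ 2 * \sum_(i < L) \sum_(j < L) (g k.1 l.1 ^+ i * g k.2 l.2 ^+ j)).
  rewrite pair_big mulr_sumr; apply: eq_bigr => -[i j] _ /=.
  rewrite /wave /= !rmorphM !rmorphXn fmorphV rmorph_nat /= !exprMn expr2.
  by rewrite mulrACA; congr (_ * _); rewrite mulrACA.
under eq_bigr do rewrite -mulr_sumr gs.
rewrite -mulr_suml gs.
have -> : (k == l) = (k.1 == l.1) && (k.2 == l.2) by [].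
case: eqVneq => _ /=; last by rewrite !mul0r mulr0.
case: eqVneq => _ /=; last by rewrite !mul0r !mulr0.
by rewrite !mul1r -expr2 -exprMn mulVf // expr1n.
Qed.

Lemma sum_angle p m : 2 * \sum_(i < m) angle p i = pi *+ 2 / L%:R * (m%:R * (m%:R - 1) - 2 * p%:R * m%:R).
Proof.
elim: m => [|m IH]; first by rewrite big_ord0; ring.
by rewrite big_ord_recr mulrDr IH /angle -natr1; ring.
Qed.

Lemma sum_angle_sqr p m : 6 * \sum_(i < m) angle p i ^+ 2 = (pi *+ 2 / L%:R) ^+ 2 *
  (m%:R * (m%:R - 1) * (2 * m%:R - 1) - 6 * p%:R * m%:R * (m%:R - 1) + 6 * p%:R ^+ 2 * m%:R).
Proof.
elim: m => [|m IH]; first by rewrite big_ord0; ring.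
by rewrite big_ord_recr mulrDr IH /angle -natr1 /=; ring.
Qed.

(** By 2 (1 - cos x) <= x^2 each deficit is at most a^2 + b^2 + (a - b)^2. The cross term sums to
    zero by symmetry, and the sum of i^2 for |i| <= p is p (p + 1) (2 p + 1) / 3. *)
Lemma sum_wave_energy p : \sum_(k : 'I_p.*2.+1 * 'I_p.*2.+1) (6 - wave_energy k) <=
  4 / 3 * (pi *+ 2 / L%:R) ^+ 2 * p%:R * (p%:R + 1) * p.*2.+1%:R ^+ 2.
Proof.
have qE : p.*2.+1%:R = 2 * p%:R + 1 :> R by rewrite -natr1 -mul2n natrM.
have s0 : \sum_(i < p.*2.+1) angle p i = 0.
  have := sum_angle p p.*2.+1; rewrite qE => h.
  have : 2 * (\sum_(i < p.*2.+1) angle p i) = 0 by rewrite h; ring.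
  lra.
have s2 := sum_angle_sqr p p.*2.+1.
set S := \sum_(i < p.*2.+1) angle p i ^+ 2 in s2.
have -> : 4 / 3 * (pi *+ 2 / L%:R) ^+ 2 * p%:R * (p%:R + 1) * p.*2.+1%:R ^+ 2 = 4 * p.*2.+1%:R * S.
  rewrite qE in s2 *; have -> : S = (6 * S) / 6; first by field.
  by rewrite s2; field.
have <- : \sum_(k : 'I_p.*2.+1 * 'I_p.*2.+1)
   (2 * angle p k.1 ^+ 2 + 2 * angle p k.2 ^+ 2 - 2 * angle p k.1 * angle p k.2) = 4 * p.*2.+1%:R * S.
  rewrite -(pair_bigA _ (fun i j : 'I_p.*2.+1 =>
     2 * angle p i ^+ 2 + 2 * angle p j ^+ 2 - 2 * angle p i * angle p j)) /=.
  transitivity (\sum_(i < p.*2.+1) (p.*2.+1%:R * (2 * angle p i ^+ 2) + 2 * S)).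
    apply: eq_bigr => i _; rewrite sumrB big_split /= sumr_const card_ord.
    rewrite -[\sum_(j < _) 2 * angle p i * _]mulr_sumr s0 mulr0 subr0.
    by rewrite -[\sum_(j < _) 2 * _]mulr_sumr -/S -[_ *+ p.*2.+1]mulr_natl.
  rewrite big_split /= sumr_const card_ord -mulr_sumr -mulr_sumr -/S -[_ *+ p.*2.+1]mulr_natl; ring.
apply: ler_sum => k _; rewrite /wave_energy.
have := one_sub_cos_le (angle p k.1); have := one_sub_cos_le (angle p k.2).
have := one_sub_cos_le (angle p k.1 - angle p k.2).
by move: (angle p k.1) (angle p k.2) => a b; nra.
Qed.

End PlaneWaves.

(** Take the smallest block of momenta with room for n holes and its best n members. Their total
    deficit is at most n times the block average, and multiplied by n it is at most 16 p (p + 1),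
    which is below 10 n. *)
Lemma hole_momenta (R : realType) (L n : nat) : (0 < L)%N -> (2 * n <= L)%N ->
  exists p (S : {set 'I_p.*2.+1 * 'I_p.*2.+1}), [/\ (p.*2 < L)%N, #|S| = n
    & (4 <= n)%N -> 6 * n%:R - 10 < \sum_(k in S) wave_energy R L k].
Proof.
move=> L0 nL.
have ex : exists p, (n <= p.*2.+1 ^ 2)%N by exists n; nia.
case: (ex_minnP ex) => p np pmin.
(* Minimality of [p] says (2 p - 1)^2 < n. *)
have p_small : (0 < p)%N -> (4 * (p * p) + 2 <= n + 4 * p)%N.
  move=> p0; have := pmin p.-1; case: p p0 {np pmin} => // p _ /= h.
  by rewrite leqNgt; apply/negP => h'; have := h ltac:(nia); rewrite ltnn.
have pL : (p.*2 < L)%N.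
  case: (posnP p) => [->//|p0]; have := p_small p0.
  have : (2 * p <= p * p + 1)%N by nia.
  rewrite -mul2n; lia.
have cK : #|{: 'I_p.*2.+1 * 'I_p.*2.+1}| = (p.*2.+1 ^ 2)%N by rewrite card_prod card_ord.
have nK : (n <= #|{: 'I_p.*2.+1 * 'I_p.*2.+1}|)%N by rewrite cK.
have [S cS hS] := average_subset (fun k => 6 - wave_energy R L k) nK.
exists p, S; split=> // n4; move: hS; rewrite cK sumrB sumr_const cS.
have := sum_wave_energy R L0 p.
have LR : 0 < L%:R :> R by rewrite ltr0n.
have nR : 4 <= n%:R :> R by rewrite (ler_nat R 4).
have nLR : 2 * n%:R <= L%:R :> R by rewrite -(natrM _ 2) ler_nat.
have pi12 := pi_sqr_le12 R.
have pR : 0 <= p%:R :> R by [].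
(* For p = 1 this is 32 < 40, where n >= 4 is needed. For p >= 2 insert n >= 4 p^2 - 4 p + 2: the
   difference is at least (p - 2) (24 p - 8) + 4. *)
have small : 16 * (p%:R * (p%:R + 1)) < 10 * n%:R :> R.
  case: (posnP p) => [->|p0]; first by rewrite mul0r mulr0; lra.
  case: (eqVneq p 1%N) => [->|p1]; first lra.
  have p2 : 2 <= p%:R :> R by rewrite (ler_nat R 2); lia.
  have : 4 * (p%:R * p%:R) + 2 <= n%:R + 4 * p%:R :> R.
    by have := p_small p0; rewrite -(ler_nat R) !natrD !natrM; lra.
  have : 0 <= (p%:R - 2) * (24 * p%:R - 8) :> R by apply: mulr_ge0; lra.
  lra.
have q0 : 0 < p.*2.+1%:R ^+ 2 :> R by rewrite exprn_gt0 // ltr0n.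
rewrite natrX; move: q0 (\sum_(i in S) wave_energy R L i) (\sum_k (6 - wave_energy R L k)).
move: (p.*2.+1%:R ^+ 2) => q q0 w W hW hw.
(* Here 2 n <= L turns the left side into at most pi^2; together with the factor 4/3 this is the
   origin of the 16 below. *)
have hL : (pi *+ 2 / L%:R) ^+ 2 * (n%:R * n%:R) <= 12 :> R.
  rewrite mulr2n expr_div_n mulrAC ler_pdivrMr ?exprn_gt0 //.
  have : 0 <= (pi : R) ^+ 2 by rewrite sqr_ge0.
  have : 4 * (n%:R * n%:R) <= L%:R ^+ 2 :> R by nra.
  nra.
move: ((pi *+ 2 / L%:R) ^+ 2) hL hW => X hL hW.
have P0 : 0 <= p%:R * (p%:R + 1) :> R by rewrite mulr_ge0 // addr_ge0.
have h1 : 6 * n%:R - w <= 4 / 3 * (n%:R * X * (p%:R * (p%:R + 1))).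
  rewrite -(ler_pM2l q0) [6 * _]mulr_natr; apply: le_trans hw _.
  apply: le_trans (ler_wpM2l _ hW) _; first lra.
  lra.
have h2 : n%:R * (6 * n%:R - w) <= 16 * (p%:R * (p%:R + 1)).
  apply: le_trans (ler_wpM2l _ h1) _; first lra.
  have := ler_wpM2r P0 hL; lra.
have h3 : n%:R * (6 * n%:R - w) < n%:R * 10 by lra.
by move: h3; rewrite ltr_pM2l; lra.
Qed.

(** * The polarized trial state with plane waves removed *)

Section TrialState.
Variables (R : realType) (L : nat) (o : bond L -> bool) (V : lmodType R[i]).
Local Notation C := R[i].
Local Notation X := (site L).
Local Notation tl := (btail o).
Local Notation hd := (bhead o).
Variable ip : V -> V -> R.
Hypotheses (ipC : forall u v, ip u v = ip v u)
  (ipDr : forall u v w, ip u (v + w) = ip u v + ip u w)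
  (ipZr : forall u (a : R) v, ip u (a%:C *: v) = a * ip u v)
  (ipJ : forall u (a : C) v, ip (Num.conj a *: u) v = ip u (a *: v)).
Variables an cr : X -> bool -> {linear V -> V}.
Hypotheses (an_an : forall x s y r v, an x s (an y r v) = - an y r (an x s v))
  (cr_cr : forall x s y r v, cr x s (cr y r v) = - cr y r (cr x s v))
  (an_cr : forall x s y r v,
     an x s (cr y r v) = (if (x == y) && (s == r) then v else 0) - cr y r (an x s v))
  (cr2_0 : forall x s v, cr x s (cr x s v) = 0)
  (ip_cr : forall x s u v, ip (cr x s u) v = ip u (an x s v)).
Variable P : nat -> V -> Prop.
Hypotheses (P0 : forall n, P n 0) (PZ : forall n (a : C) u, P n u -> P n (a *: u))
  (PD : forall n u v, P n u -> P n v -> P n (u + v))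
  (P_an : forall n x s u, P n u -> P n.-1 (an x s u))
  (P_cr : forall n x s u, P n u -> P n.+1 (cr x s u)).
Variable vac : V.
Hypotheses (an_vac : forall x s, an x s vac = 0) (P_vac : P 0 vac) (vac1 : ip vac vac = 1).
Hypothesis tl_hd : forall b, tl b != hd b.

Local Notation hop := (hopping tl hd an cr).

Definition filled (l : seq X) : V := foldr (fun x u => cr x true u) vac l.

Lemma an_filled l x s : (x \notin l) || ~~ s -> an x s (filled l) = 0.
Proof.
elim: l => [|y l IH] /=; first by rewrite an_vac.
rewrite inE negb_or => h; rewrite an_cr.
have -> : (x == y) && (s == true) = false by move: h; rewrite eqb_id; case: (x == y); case: (s).
rewrite IH; first by rewrite linear0 subr0.
by case/orP: h => [/andP[_ ->]|->]; rewrite ?orbT.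
Qed.

Lemma cr_filled l x : x \in l -> cr x true (filled l) = 0.
Proof.
elim: l => // y l IH; rewrite inE => /orP[/eqP ->|xl] /=; first exact: cr2_0.
by rewrite cr_cr IH // linear0 oppr0.
Qed.

Lemma P_filled l : P (size l) (filled l).
Proof. by elim: l => //= x l IH; apply: P_cr. Qed.

Lemma norm_filled l : uniq l -> ip (filled l) (filled l) = 1.
Proof.
elim: l => //= x l IH /andP[xl ul].
by rewrite ip_cr an_cr !eqxx /= an_filled ?xl // linear0 subr0 IH.
Qed.

Let full := filled (enum {: X}).

(** Every move of an up electron is blocked by the Pauli principle, and there are no down
    electrons. *)
Lemma hop_full : hop full = 0.
Proof.
rewrite /hopping big1 // => b _; rewrite big1 // => s _.
have e x y : x != y -> cr x s (an y s full) = 0.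
  move=> xy; case: s; last by rewrite an_filled ?orbT // linear0.
  have := an_cr y true x true full.
  rewrite eq_sym (negbTE xy) cr_filled ?mem_enum // linear0 sub0r => /esym/eqP.
  by rewrite oppr_eq0 => /eqP.
transitivity (0 + 0 : V); last by rewrite addr0.
by congr (_ + _); apply: e; rewrite // eq_sym.
Qed.

Definition anf (f : X -> C) (u : V) : V := \sum_x f x *: an x true u.
Definition crf (f : X -> C) (u : V) : V := \sum_x Num.conj (f x) *: cr x true u.

Lemma anf_linear f : linear (anf f).
Proof.
move=> c u v; rewrite /anf scaler_sumr -big_split; apply: eq_bigr => x _ /=.
by rewrite linearP scalerDr !scalerA mulrC.
Qed.
HB.instance Definition _ f := GRing.isLinear.Build C V V *:%R (anf f) (anf_linear f).

Lemma crf_anf f g u :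
  crf f (anf g u) = (\sum_x Num.conj (f x) * g x) *: u - anf g (crf f u).
Proof.
have -> : (\sum_x Num.conj (f x) * g x) *: u =
    \sum_x \sum_y (g x * Num.conj (f y)) *: (if (x == y) && (true == true) then u else 0).
  rewrite scaler_suml; apply: eq_bigr => x _.
  rewrite (bigD1 x) //= eqxx [X in _ + X]big1 ?addr0 1?mulrC // => y yx.
  by rewrite eq_sym (negbTE yx) scaler0.
have crZ z c v : cr z true (c *: v) = c *: cr z true v by rewrite linearZ.
have anZ z c v : an z true (c *: v) = c *: an z true v by rewrite linearZ.
rewrite /anf /crf.
under [in LHS]eq_bigr do rewrite linear_sum scaler_sumr.
under [X in _ - X]eq_bigr do rewrite linear_sum scaler_sumr.
rewrite [in LHS]exchange_big -sumrB; apply: eq_bigr => x _; rewrite -sumrB.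
apply: eq_bigr => y _; rewrite crZ anZ !scalerA [Num.conj _ * _]mulrC -scalerBr.
by congr (_ *: _); rewrite an_cr opprB addrC subrK.
Qed.

Lemma ip_sum0r u : ip u 0 = 0.
Proof. by rewrite -(scale0r u) -[0]/((0 : R)%:C) ipZr mul0r. Qed.

Lemma ip_crf f u v : ip (crf f u) v = ip u (anf f v).
Proof.
have sr (F : X -> V) w : ip w (\sum_x F x) = \sum_x ip w (F x).
  exact: (big_morph (ip w) (ipDr w) (ip_sum0r w)).
by rewrite ipC /crf /anf !sr; apply: eq_bigr => x _; rewrite ipC ipJ ip_cr linearZ.
Qed.

Lemma crf_full f : crf f full = 0.
Proof. by rewrite /crf big1 // => x _; rewrite cr_filled ?mem_enum // scaler0. Qed.

Lemma hop_linear : linear hop.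
Proof.
move=> c u v; rewrite /hopping scaler_sumr -big_split; apply: eq_bigr => b _ /=.
rewrite scaler_sumr -big_split; apply: eq_bigr => s _ /=.
by rewrite !linearP addrACA -scalerDr.
Qed.

Lemma sum_bond_swap (F : X -> X -> V) :
  \sum_b (F (tl b) (hd b) + F (hd b) (tl b)) = \sum_d \sum_x (F x (nbr d x) + F (nbr d x) x).
Proof.
rewrite pair_big /=; apply: eq_bigr => -[d x] _ /=.
by rewrite /btail /bhead; case: ifP => //= _; rewrite addrC.
Qed.

(** Regrouped by direction, the two orientations of the bonds contribute [lam d] and its inverse.
    The sign is that of a removed electron: a hole in a mode of eigenvalue eps lowers the hopping
    energy by eps. *)
Lemma hop_anf f lam eps u : bloch f lam eps ->
  hop (anf f u) = anf f (hop u) - eps%:C *: anf f u.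
Proof.
move=> [hf lam0 <-].
have hop0 : hop 0 = 0.
  by have := hopping_is_additive tl hd an cr 0 0; rewrite !subrr.
have hopZ c v : hop (c *: v) = c *: hop v.
  by have := hop_linear c v 0; rewrite !addr0 hop0 addr0.
have hopD v w : hop (v + w) = hop v + hop w by have := hop_linear 1 v w; rewrite !scale1r.
rewrite {1}/anf (big_morph hop hopD hop0).
under eq_bigr do rewrite hopZ hopping_an // scalerBr.
rewrite sumrB; congr (_ - _).
transitivity (\sum_b (f (tl b) *: an (hd b) true u + f (hd b) *: an (tl b) true u)).
  under eq_bigr do rewrite scaler_sumr.
  rewrite exchange_big; apply: eq_bigr => b _ /=.
  under eq_bigr do rewrite scalerDr.
  rewrite big_split /=; congr (_ + _).
    rewrite (bigD1 (tl b)) //= eqxx [X in _ + X]big1 ?addr0 // => x.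
    by rewrite eq_sym => /negbTE->; rewrite scaler0.
  rewrite (bigD1 (hd b)) //= eqxx [X in _ + X]big1 ?addr0 // => x.
  by rewrite eq_sym => /negbTE->; rewrite scaler0.
rewrite (sum_bond_swap (fun x y => f x *: an y true u)) scaler_suml.
apply: eq_bigr => d _; rewrite big_split /= scalerDl addrC; congr (_ + _).
  by rewrite /anf scaler_sumr; apply: eq_bigr => x _; rewrite hf scalerA.
rewrite /anf scaler_sumr [RHS](reindex_inj (@nbr_inj L d)) /=.
by apply: eq_bigr => x _; rewrite scalerA hf mulKf.
Qed.

Lemma an_anf x f u : an x false (anf f u) = - anf f (an x false u).
Proof.
rewrite /anf linear_sum -sumrN; apply: eq_bigr => y _.
by rewrite linearZ /= an_an scalerN.
Qed.

Section Holes.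
Variables (J : finType) (w : J -> X -> C) (eps : J -> R).
Hypotheses (w_orth : forall j k, \sum_x Num.conj (w j x) * w k x = (j == k)%:R)
  (w_bloch : forall j, exists lam, bloch (w j) lam (eps j)).

Definition holes (l : seq J) : V := foldr (fun j u => anf (w j) u) full l.

(** Creating an electron annihilates a hole: [crf] anticommutes past orthogonal waves and kills the
    full state. This is how the norm of the trial state is computed. *)
Lemma crf_holes l j : j \notin l -> crf (w j) (holes l) = 0.
Proof.
elim: l => [|k l IH] /=; first by rewrite crf_full.
rewrite inE negb_or => /andP[/negbTE jk jl].
by rewrite crf_anf w_orth jk scale0r IH // linear0 subr0.
Qed.

Lemma norm_holes l : uniq l -> ip (holes l) (holes l) = 1.
Proof.
elim: l => [_|j l IH /= /andP[jl ul]]; first by rewrite norm_filled // enum_uniq.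
rewrite -ip_crf crf_anf w_orth eqxx scale1r crf_holes // linear0 subr0; exact: IH.
Qed.

Lemma an_holes l x : an x false (holes l) = 0.
Proof.
elim: l => [|j l IH] /=; first by rewrite an_filled ?orbT.
by rewrite an_anf IH linear0 oppr0.
Qed.

Lemma P_anf n f u : P n u -> P n.-1 (anf f u).
Proof.
move=> Pu; apply: (big_ind (P n.-1)) => // [u' v'|x _]; first exact: PD.
exact/PZ/P_an.
Qed.

Lemma P_holes l : P (#|{: X}| - size l) (holes l).
Proof.
elim: l => [|j l IH] /=; first by rewrite subn0 cardT; apply: P_filled.
by rewrite subnS; apply: P_anf.
Qed.

Lemma hop_holes l : hop (holes l) = - (\sum_(j <- l) eps j)%:C *: holes l.
Proof.
elim: l => [|j l IH] /=; first by rewrite hop_full big_nil oppr0 scale0r.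
have [lam hb] := w_bloch j.
by rewrite (hop_anf _ hb) IH linearZ /= -scalerBl big_cons rmorphD opprD addrC.
Qed.

Lemma trial_state (S : {set J}) : exists u, [/\ P (#|{: X}| - #|S|) u, ip u u = 1,
  forall x, an x false u = 0 & ip u (hop u) = - \sum_(j in S) eps j].
Proof.
exists (holes (enum S)); split.
- by rewrite cardE; apply: P_holes.
- by rewrite norm_holes // enum_uniq.
- by move=> x; apply: an_holes.
by rewrite hop_holes -rmorphN ipZr norm_holes ?enum_uniq // mulr1 big_enum.
Qed.

End Holes.
End TrialState.

(** * The modes [a] and [b] as coefficient functions on Lambda *)

Section Coefficients.
Variables (R : realType) (L : nat) (o : bond L -> bool) (mu : R).
Local Notation C := R[i].
Local Notation tl := (btail o).
Local Notation hd := (bhead o).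

Definition aF (x : site L) (z : lsite L) : C := (a_coef o mu x z)%:C.
Definition buF (b : bond L) (z : lsite L) : C := (bu_coef o mu b z)%:C.
Definition bubF (b : bond L) (z : lsite L) : C := (bub_coef o mu b z)%:C.
Definition anorm : R := Num.sqrt (1 + 2 * zeta R * mu ^+ 2).

Lemma anorm_gt0 : 0 < anorm.
Proof.
rewrite sqrtr_gt0 /zeta; apply: ltr_pwDl => //.
by rewrite mulr_ge0 ?sqr_ge0 // mulr_ge0.
Qed.

Lemma anorm_sqr : anorm ^+ 2 = 1 + 12 * mu ^+ 2.
Proof.
rewrite sqr_sqrtr; first by rewrite /zeta -natrM.
by rewrite addr_ge0 // /zeta mulr_ge0 ?sqr_ge0 // mulr_ge0.
Qed.

Section Combination.
Variable V : lmodType C.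
Implicit Types W : lsite L -> V.

(** The target is a general module, so the same identities serve for overlaps (values in C) and for
    annihilation operators (values in Fock space). *)
Definition comb (f : lsite L -> C) W : V := \sum_z f z *: W z.

Lemma comb_delta (c : R) z0 W :
  \sum_z (c * (if z == z0 then 1 else 0))%:C *: W z = c%:C *: W z0.
Proof.
rewrite (bigD1 z0) //= eqxx mulr1 [X in _ + X]big1 ?addr0 // => z /negbTE->.
by rewrite mulr0 scale0r.
Qed.

Lemma comb_bu b W :
  comb (buF b) W = W (usite b) - mu%:C *: W (inl (tl b)) - mu%:C *: W (inl (hd b)).
Proof.
rewrite -[W (usite b)]scale1r -[1]/((1 : R)%:C) -!comb_delta -!sumrB.
by apply: eq_bigr => z _; rewrite -!scalerBl -!rmorphB /= mul1r.
Qed.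

Lemma comb_bub b W :
  comb (bubF b) W = W (ubsite b) + mu%:C *: W (inl (tl b)) - mu%:C *: W (inl (hd b)).
Proof.
rewrite -[W (ubsite b)]scale1r -[1]/((1 : R)%:C) -!comb_delta -big_split -sumrB.
by apply: eq_bigr => z _ /=; rewrite -scalerDl -scalerBl -rmorphD -rmorphB /= mul1r.
Qed.

Definition pick (p : bool) (v : V) : V := if p then v else 0.

Lemma comb_a x W : comb (aF x) W = (anorm^-1)%:C *: (W (inl x) + mu%:C *:
  \sum_b (pick (tl b == x) (W (usite b) - W (ubsite b))
        + pick (hd b == x) (W (usite b) + W (ubsite b)))).
Proof.
rewrite /comb !big_sumType /= scalerDr; congr (_ + _).
  rewrite (bigD1 x) //= /aF /a_coef eqxx mulr1 [X in _ + X]big1 ?addr0 // => y /negbTE->.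
  by rewrite mulr0 scale0r.
rewrite !scaler_sumr -big_split; apply: eq_bigr => b _ /=.
rewrite /aF /a_coef -/anorm !rmorphM /= -!scalerA -scalerDr; congr (_ *: _).
rewrite !rmorphD /= !scalerDl /pick -/(usite b) -/(ubsite b).
have pZ (p : bool) (c : R) v : (if p then c else 0)%:C *: v = pick p (c%:C *: v).
  by case: p; rewrite /pick ?scale0r.
have Zp (p : bool) v : mu%:C *: pick p v = pick p (mu%:C *: v).
  by case: p; rewrite /pick ?scaler0.
have pD (p : bool) v v' : pick p v + pick p v' = pick p (v + v').
  by case: p; rewrite /pick ?addr0.
by rewrite !pZ scalerDr !Zp addrACA !pD rmorphN scaleNr scalerDr scalerN scalerDr.
Qed.

Definition flat W := forall b, comb (buF b) W = 0 /\ comb (bubF b) W = 0.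

Lemma flat_u W b : flat W -> W (usite b) = mu%:C *: (W (inl (tl b)) + W (inl (hd b))).
Proof.
move=> /(_ b)[]; rewrite comb_bu => /eqP; rewrite !subr_eq add0r => /eqP-> _.
by rewrite scalerDr addrC.
Qed.

Lemma flat_ub W b : flat W -> W (ubsite b) = mu%:C *: (W (inl (hd b)) - W (inl (tl b))).
Proof.
move=> /(_ b)[] _; rewrite comb_bub => /eqP; rewrite subr_eq add0r => /eqP e.
by rewrite scalerBr -e addrK.
Qed.

Lemma sum_pick (F : site L -> V) x :
  \sum_b (pick (tl b == x) (F (tl b)) + pick (hd b == x) (F (hd b))) = 6%:R *: F x.
Proof.
transitivity (\sum_b (((tl b == x) + (hd b == x))%:R : C) *: F x).
  apply: eq_bigr => b _; rewrite natrD scalerDl /pick.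
  by congr (_ + _); case: eqP => [->|_]; rewrite ?scale1r ?scale0r.
rewrite -scaler_suml -natr_sum (sum_ends o (fun y => (y == x : nat))).
rewrite (bigD1 x) //= eqxx big1 ?addn0 ?muln1 // => y /negbTE->//.
Qed.

(** The auxiliary values, determined by the lattice values, combine to 2 mu times the value at [x]
    for each of the six bonds at [x], and 1 + 12 mu^2 is the square of the normalization. *)
Lemma comb_a_flat x W : flat W -> comb (aF x) W = anorm%:C *: W (inl x).
Proof.
move=> fW; rewrite comb_a.
transitivity ((anorm^-1)%:C *: (W (inl x) + mu%:C *: ((2 * mu)%:C *: (6%:R *: W (inl x))))).
  congr (_ *: (_ + _ *: _)); rewrite -(sum_pick (fun x => W (inl x))) scaler_sumr.
  apply: eq_bigr => b _; rewrite (flat_u _ fW) (flat_ub _ fW) -scalerBr -scalerDr.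
  have -> : W (inl (tl b)) + W (inl (hd b)) - (W (inl (hd b)) - W (inl (tl b))) = 2%:R *: W (inl (tl b)).
    by rewrite opprB addrACA subrr addr0 scaler_nat mulr2n.
  have -> : W (inl (tl b)) + W (inl (hd b)) + (W (inl (hd b)) - W (inl (tl b))) = 2%:R *: W (inl (hd b)).
    by rewrite [W (inl (tl b)) + _]addrC addrACA subrr addr0 scaler_nat mulr2n.
  rewrite !scalerA [mu%:C * _]mulrC -[2%:R]/(2%:R : C) -(rmorph_nat (real_complex R) 2) -rmorphM /=.
  by rewrite /pick scalerDr; congr (_ + _); case: ifP; rewrite ?scaler0.
rewrite !scalerA -[6%:R]/(6%:R : C) -(rmorph_nat (real_complex R) 6) -!rmorphM /= -[W _ in X in X + _]scale1r.
rewrite -[1]/((1 : R)%:C) -scalerDl -rmorphD scalerA -rmorphM /=; congr (_%:C *: _).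
have n0 := anorm_gt0; have -> : 1 + mu * (2 * mu) * 6 = anorm ^+ 2 by rewrite anorm_sqr; ring.
by rewrite expr2 mulKf // gt_eqF.
Qed.

End Combination.

(* A function annihilated by all [b] lies in the span of the orthonormal [a] modes. *)
Lemma sum_flat (V V' : lmodType C) (W : lsite L -> V) (F : lsite L -> {linear V -> V'}) :
  flat W -> \sum_z F z (W z) = \sum_x comb (aF x) (fun z => F z (comb (aF x) W)).
Proof.
move=> fW; rewrite !big_sumType /=.
have n0 := anorm_gt0.
have aZ z (c : R) v : F z (c%:C *: v) = c%:C *: F z v by rewrite linearZ.
transitivity (\sum_x (F (inl x) (W (inl x)) + mu%:C *:
  \sum_b (pick (tl b == x) (F (usite b) (W (inl x)) - F (ubsite b) (W (inl x)))
        + pick (hd b == x) (F (usite b) (W (inl x)) + F (ubsite b) (W (inl x)))))); last first.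
  apply: eq_bigr => x _; rewrite (comb_a_flat x fW) comb_a !aZ.
  transitivity ((anorm^-1)%:C *: (anorm%:C *: (F (inl x) (W (inl x)) + mu%:C *:
    \sum_b (pick (tl b == x) (F (usite b) (W (inl x)) - F (ubsite b) (W (inl x)))
        + pick (hd b == x) (F (usite b) (W (inl x)) + F (ubsite b) (W (inl x))))))).
    by rewrite scalerA -rmorphM /= mulVf ?gt_eqF // scale1r.
  congr (_ *: _); rewrite scalerDr; congr (_ + _).
  rewrite scalerA mulrC -scalerA; congr (_ *: _); rewrite scaler_sumr; apply: eq_bigr => b _.
  rewrite !aZ -scalerBr -scalerDr [LHS]scalerDr /pick.
  by congr (_ + _); case: ifP; rewrite ?scaler0.
rewrite big_split /=; congr (_ + _); rewrite -scaler_sumr exchange_big scaler_sumr -big_split.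
apply: eq_bigr => b _ /=; rewrite -/(usite b) -/(ubsite b) (flat_u _ fW) (flat_ub _ fW) !aZ -scalerDr.
congr (_ *: _); rewrite big_split /=.
have pk y (H : site L -> V') : \sum_x pick (y == x) (H x) = H y.
  by rewrite (bigD1 y) //= /pick eqxx big1 ?addr0 // => x; rewrite eq_sym => /negbTE->.
rewrite (pk (tl b) (fun x => F (usite b) (W (inl x)) - F (ubsite b) (W (inl x)))).
rewrite (pk (hd b) (fun x => F (usite b) (W (inl x)) + F (ubsite b) (W (inl x)))).
by rewrite linearD linearB /= [F (ubsite b) _ - _]addrC addrACA.
Qed.

Let CJ (a : R) : Num.conj (a%:C) = a%:C.
Proof. exact: conjc_real. Qed.

Lemma flat_a y : flat (V := C^o) (aF y).
Proof.
have e (p q r : R) : p%:C - mu%:C * q%:C - mu%:C * r%:C = (p - mu * q - mu * r)%:C :> C.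
  by rewrite !rmorphB !rmorphM.
have e' (p q r : R) : p%:C + mu%:C * q%:C - mu%:C * r%:C = (p + mu * q - mu * r)%:C :> C.
  by rewrite rmorphB rmorphD !rmorphM.
move=> b; split.
  rewrite comb_bu; apply: etrans (e _ _ _) _; rewrite /a_coef /=.
  by rewrite [X in X%:C](_ : _ = 0) //; case: (tl b == y); case: (hd b == y); ring.
rewrite comb_bub; apply: etrans (e' _ _ _) _; rewrite /a_coef /=.
by rewrite [X in X%:C](_ : _ = 0) //; case: (tl b == y); case: (hd b == y); ring.
Qed.

Lemma dotp_comb (f : lsite L -> R) (g : lsite L -> C) :
  dotp (fun z => (f z)%:C) g = comb (V := C^o) (fun z => (f z)%:C) g.
Proof. by apply: eq_bigr => z _; rewrite CJ. Qed.

(** Each mode [aF y] is itself flat, so its overlap with [aF x] is read off from its value at the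
    lattice site [x]. *)
Lemma dotp_aa x y : dotp (aF x) (aF y) = (x == y)%:R.
Proof.
rewrite dotp_comb (comb_a_flat x (flat_a y)) /aF /a_coef /= -/anorm.
apply: etrans (esym (rmorphM (real_complex R) _ _)) _; rewrite /= mulVKf ?gt_eqF ?anorm_gt0 //.
by case: (x == y).
Qed.

Lemma dotp_bua b y : dotp (buF b) (aF y) = 0.
Proof. by rewrite dotp_comb; apply: (flat_a y b).1. Qed.
Lemma dotp_buba b y : dotp (bubF b) (aF y) = 0.
Proof. by rewrite dotp_comb; apply: (flat_a y b).2. Qed.

Lemma dotpC f g : dotp f g = Num.conj (dotp (L := L) g f) :> C.
Proof.
rewrite /dotp rmorph_sum; apply: eq_bigr => z _.
transitivity (Num.conj (Num.conj (g z) * f z)) => //.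
by rewrite conjJM mulrC.
Qed.

Lemma dotp_abu b y : dotp (aF y) (buF b) = 0.
Proof. by rewrite dotpC dotp_bua rmorph0. Qed.
Lemma dotp_abub b y : dotp (aF y) (bubF b) = 0.
Proof. by rewrite dotpC dotp_buba rmorph0. Qed.

End Coefficients.

Lemma singlet_linear (R : realType) (V : lmodType R[i]) (X : finType)
    (an : X -> bool -> {linear V -> V}) x y (c : R[i]) u v :
  singlet (fun x s => an x s) x y (c *: u + v) =
  c *: singlet (fun x s => an x s) x y u + singlet (fun x s => an x s) x y v.
Proof. by rewrite /singlet /= !linearP scalerDr addrACA. Qed.

(** * The Hubbard model as an instance of the abstract setting *)

Section Model.
Variables (R : realType) (L : nat) (o : bond L -> bool) (mu : R).
Local Notation C := R[i].
Local Notation tl := (btail o).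
Local Notation hd := (bhead o).
Local Notation V := (fock R L).
Local Notation aF := (aF o mu).
Local Notation buF := (buF o mu).
Local Notation bubF := (bubF o mu).
Local Notation N := (anorm mu).
Implicit Types (phi psi : V) (s r q : bool) (b : bond L) (x y : site L).

Definition ax x s : {linear V -> V} := An (aF x) s.
Definition cx x s : {linear V -> V} := Cr (aF x) s.
Definition hop psi : V := hopping tl hd (fun x s => ax x s) (fun x s => cx x s) psi.

Definition flat_band psi := forall s b, An (buF b) s psi = 0 /\ An (bubF b) s psi = 0.

Lemma flat_band_flat psi s : flat_band psi -> flat o mu (fun z => ann (z, s) psi).
Proof. by move=> h b; apply: h. Qed.

Lemma flat_band0 : flat_band 0.
Proof. by move=> s b; rewrite !linear0. Qed.
Lemma flat_bandZ (c : C) psi : flat_band psi -> flat_band (c *: psi).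
Proof. by move=> h s b; have [h1 h2] := h s b; rewrite !linearZ /= h1 h2 scaler0. Qed.
Lemma flat_bandD phi psi : flat_band phi -> flat_band psi -> flat_band (phi + psi).
Proof.
by move=> h h' s b; have [h1 h2] := h s b; have [h3 h4] := h' s b; rewrite !linearD /= h1 h2 h3 h4 addr0.
Qed.
Lemma flat_bandB phi psi : flat_band phi -> flat_band psi -> flat_band (phi - psi).
Proof. by move=> h h'; rewrite -scaleN1r; apply: flat_bandD => //; apply: flat_bandZ. Qed.
Lemma flat_band_An f q psi : flat_band psi -> flat_band (An f q psi).
Proof. by move=> h s b; have [h1 h2] := h s b; rewrite !(An_An _ s) h1 h2 linear0 oppr0. Qed.
Lemma flat_band_ax x q psi : flat_band psi -> flat_band (ax x q psi).
Proof. exact: flat_band_An. Qed.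
Lemma flat_band_cx x q psi : flat_band psi -> flat_band (cx x q psi).
Proof.
move=> h s b; have [h1 h2] := h s b.
by rewrite !An_Cr h1 h2 dotp_abu dotp_abub linear0 if_same scale0r subr0.
Qed.
Lemma flat_band_E s r psi : flat_band psi -> flat_band (E s r psi).
Proof.
move=> h q b; have [h1 h2] := h q b; have [h3 h4] := h r b.
have e f : An f q (E s r psi) = E s r (An f q psi) + (if s == q then An f r psi else 0).
  by rewrite E_An subrK.
by rewrite !e h1 h2 h3 h4 linear0 if_same addr0.
Qed.

Lemma An_ann f s j psi : An f s (ann j psi) = - ann j (An f s psi).
Proof.
rewrite /An linear_sum -sumrN; apply: eq_bigr => z _.
by rewrite linearZ /= ann_ann scalerN.
Qed.

Lemma flat_band_ann j psi : flat_band psi -> flat_band (ann j psi).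
Proof. by move=> h s b; have [h1 h2] := h s b; rewrite !An_ann h1 h2 linear0 oppr0. Qed.

Definition flat_space n psi := flat_band psi /\ n_electron n psi.

Definition vac : V := [ffun A => (A == finset.set0)%:R].

Lemma An_vac f s : An f s vac = 0.
Proof.
rewrite /An big1 // => z _; apply/ffunP => A; rewrite !ffunE; case: ifP => _; first by rewrite scaler0.
rewrite (_ : _ == _ = false) ?mulr0 ?scaler0 //; apply/negbTE/set0Pn.
by exists (z, s); rewrite finset.setU11.
Qed.

Lemma ip_vac : ip vac vac = 1.
Proof.
rewrite /ip /inner (bigD1 finset.set0) //= big1 ?addr0; last first.
  by move=> A A0; rewrite !ffunE (negbTE A0) mulr0.
by rewrite !ffunE eqxx rmorph1 mulr1.
Qed.

Lemma flat_space_vac : flat_space 0 vac.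
Proof.
split=> [s b|A hA]; last by rewrite ffunE -cards_eq0 (negbTE hA).
by rewrite !An_vac.
Qed.

Lemma ipJ phi (a : C) psi : ip (Num.conj a *: phi) psi = ip phi (a *: psi).
Proof.
rewrite /ip; f_equal; apply: eq_bigr => A _.
by rewrite !fock_scaleE conjJM mulrCA mulrA.
Qed.

Lemma cx2_0 x s psi : cx x s (cx x s psi) = 0.
Proof. by apply: (self_opp0 (@ipDr R L) (@ip_eq0 R L)); apply: Cr_Cr. Qed.

Lemma E_hop s r psi : flat_band psi -> E s r psi = \sum_x cx x s (ax x r psi).
Proof.
move=> h; rewrite /E.
rewrite (@sum_flat _ _ o mu _ _ (fun z => ann (z, r) psi) (fun z => cre (z, s)) (flat_band_flat r h)).
apply: eq_bigr => x _; apply: eq_bigr => z _ /=.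
by congr (_ *: _); apply: esym; apply: conjc_real.
Qed.

Lemma ax_ann x s psi : flat_band psi -> ax x s psi = N%:C *: ann (inl x, s) psi.
Proof. by move=> /(flat_band_flat s)/(comb_a_flat x). Qed.

Lemma ax_ax x s y r psi : flat_band psi ->
  ax x s (ax y r psi) = (N ^+ 2)%:C *: ann (inl x, s) (ann (inl y, r) psi).
Proof.
move=> h; rewrite (ax_ann y) // linearZ /= (ax_ann x); last exact: flat_band_ann.
by rewrite scalerA -rmorphM expr2.
Qed.

Lemma ann_u b s psi : flat_band psi ->
  ann (usite b, s) psi = mu%:C *: (ann (inl (tl b), s) psi + ann (inl (hd b), s) psi).
Proof. by move=> /(flat_band_flat s)/(flat_u b). Qed.
Lemma ann_ub b s psi : flat_band psi ->
  ann (ubsite b, s) psi = mu%:C *: (ann (inl (hd b), s) psi - ann (inl (tl b), s) psi).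
Proof. by move=> /(flat_band_flat s)/(flat_ub b). Qed.

Definition cc psi x y : V := ann (inl x, true) (ann (inl y, false) psi).

Lemma double_u b psi : flat_band psi -> ann (usite b, true) (ann (usite b, false) psi) =
  mu%:C *: (mu%:C *: (cc psi (tl b) (tl b) + cc psi (hd b) (tl b))
            + mu%:C *: (cc psi (tl b) (hd b) + cc psi (hd b) (hd b))).
Proof.
move=> h; rewrite (ann_u _ false) // linearZ linearD /=.
by rewrite !(ann_u b true (flat_band_ann _ h)).
Qed.

Lemma double_ub b psi : flat_band psi -> ann (ubsite b, true) (ann (ubsite b, false) psi) =
  mu%:C *: (mu%:C *: (cc psi (hd b) (hd b) - cc psi (tl b) (hd b))
            - mu%:C *: (cc psi (hd b) (tl b) - cc psi (tl b) (tl b))).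
Proof.
move=> h; rewrite (ann_ub _ false) // linearZ linearB /=.
by rewrite !(ann_ub b true (flat_band_ann _ h)).
Qed.

Lemma singlet_cc x y psi : flat_band psi ->
  singlet (fun x s => ax x s) x y psi = (N ^+ 2)%:C *: (cc psi x y + cc psi y x).
Proof. by move=> h; rewrite /singlet /= !ax_ax // scalerDr. Qed.

Hypothesis mu0 : 0 < mu.

Lemma mu_neq0 : mu%:C != 0 :> C.
Proof. by apply/eqP => /(congr1 (@complex.Re R)) /= h; move: mu0; rewrite h ltxx. Qed.
Lemma N2_neq0 : (N ^+ 2)%:C != 0 :> C.
Proof.
by apply/eqP => /(congr1 (@complex.Re R)) /= h; have := anorm_gt0 mu; have := exprn_gt0 2 (anorm_gt0 mu); rewrite h ltxx.
Qed.

Variable Ne : nat.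
Local Notation adm := (admissible tl hd (fun x s => ax x s) (flat_space Ne)).

(** By the flat-band relations, a pair removal on an auxiliary site is mu^2 times the double
    removals at both ends of the bond plus or minus the singlet of the bond. *)
Lemma admissible_double_free psi : adm psi ->
  forall z, ann (z, true) (ann (z, false) psi) = 0.
Proof.
move=> [[kb _] h]; have c0 x y : adj0 tl hd x y -> cc psi x y + cc psi y x = 0.
  move=> /h; rewrite singlet_cc // => /eqP; rewrite scaler_eq0 (negbTE N2_neq0) => /eqP //.
have cxx x : cc psi x x = 0.
  have := c0 x x (adj0_refl tl hd x); rewrite -mulr2n -scaler_nat => /eqP.
  by rewrite scaler_eq0 pnatr_eq0 => /eqP.
have cth b : cc psi (hd b) (tl b) + cc psi (tl b) (hd b) = 0.
  by apply: c0; rewrite /adj0; apply/orP; right; apply/existsP; exists b; rewrite !eqxx orbT.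
case=> [x|[b|b]]; first exact: cxx.
  by rewrite -/(usite b) double_u // !cxx add0r addr0 -scalerDr cth !scaler0.
by rewrite -/(ubsite b) double_ub // !cxx sub0r subr0 scalerN -opprD -scalerDr addrC cth !scaler0 oppr0 scaler0.
Qed.

Lemma double_free_admissible psi : flat_space Ne psi ->
  (forall z, ann (z, true) (ann (z, false) psi) = 0) -> adm psi.
Proof.
move=> [kb ne] d; split=> // x y xy; rewrite singlet_cc //.
have cxx z : cc psi z z = 0 by apply: d.
have cth b : cc psi (hd b) (tl b) + cc psi (tl b) (hd b) = 0.
  have := d (usite b); rewrite double_u // !cxx add0r addr0 -scalerDr => /eqP.
  by rewrite !scaler_eq0 (negbTE mu_neq0) => /eqP.
case/orP: xy => [/eqP->|/existsP[b /orP[/andP[/eqP<- /eqP<-]|/andP[/eqP<- /eqP<-]]]].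
- by rewrite !cxx addr0 scaler0.
- by rewrite addrC cth scaler0.
- by rewrite cth scaler0.
Qed.

Lemma lc_creE w s psi : lc_cre w s psi = Cr (fun z => (w z)%:C) s psi.
Proof. by apply: eq_bigr => z _; congr (_ *: _); apply: esym; apply: conjc_real. Qed.

Definition flat_defect psi : R := \sum_b \sum_(s : bool)
  (ip (An (buF b) s psi) (An (buF b) s psi) + ip (An (bubF b) s psi) (An (bubF b) s psi)).
Definition double_occ psi : R := \sum_z
  ip (ann (z, true) (ann (z, false) psi)) (ann (z, true) (ann (z, false) psi)).

(** Adjointness turns the [s] and [U] terms into sums of squared norms, so the energy is affine in
    each with nonnegative slopes. *)
Lemma energyE (t s U : R) psi :
  energy o mu t s U psi = t * ip psi (hop psi) + s * flat_defect psi + U * double_occ psi.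
Proof.
rewrite /energy -/(ip _ _) /hamiltonian !ipDr !ipZr; congr (_ * _ + _ * _ + _ * _).
- congr ip; apply: eq_bigr => b _; apply: eq_bigr => q _.
  by rewrite /a_cre !lc_creE.
- rewrite ip_sumr; apply: eq_bigr => b _; rewrite ip_sumr; apply: eq_bigr => q _.
  by rewrite !lc_creE ipDr -!ip_An.
rewrite ip_sumr; apply: eq_bigr => z _; rewrite /num.
by rewrite -ip_ann ann_cre xpair_eqE andbF sub0r ipNr -ip_ann ann_ann ipNl opprK.
Qed.

Lemma flat_space_E s r psi : flat_space Ne psi -> flat_space Ne (E s r psi).
Proof. by move=> [h1 h2]; split; [apply: flat_band_E|apply: n_electron_E]. Qed.

Lemma flat_space_cxax x s y r psi : flat_space Ne psi -> flat_space Ne (cx x s (ax y r psi)).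
Proof.
move=> [h1 h2]; split; first exact/flat_band_cx/flat_band_ax.
apply: n_electron_sum => z; apply: n_electronZ; rewrite linear_sum.
apply: n_electron_sum => z'; rewrite linearZ; apply: n_electronZ.
exact: n_electron_cre_ann.
Qed.

Lemma flat_space_B phi psi : flat_space Ne phi -> flat_space Ne psi -> flat_space Ne (phi - psi).
Proof. by move=> [h1 h2] [h3 h4]; split; [apply: flat_bandB|apply: n_electronB]. Qed.

Lemma ax_an x s y r psi : ax x s (ax y r psi) = - ax y r (ax x s psi).
Proof. exact: An_An. Qed.
Lemma cx_cx x s y r psi : cx x s (cx y r psi) = - cx y r (cx x s psi).
Proof. exact: Cr_Cr. Qed.
Lemma ax_cx x s y r psi : ax x s (cx y r psi) =
  (if (x == y) && (s == r) then psi else 0) - cx y r (ax x s psi).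
Proof.
rewrite /ax /cx /= An_Cr dotp_aa (eq_sym y x); congr (_ - _).
by case: (x == y); case: (s == r); rewrite ?scale1r ?scale0r.
Qed.
Lemma ip_cx x s phi psi : ip (cx x s phi) psi = ip phi (ax x s psi).
Proof. exact: ip_Cr. Qed.

Lemma E_numMn psi : flat_space Ne psi -> E true true psi + E false false psi = psi *+ Ne.
Proof. by move=> [_ /E_number ->]; rewrite scaler_nat. Qed.

Lemma ground_spin_defect_eq0 (e c : R) psi : (1 < L)%N -> adm psi ->
  (forall phi, adm phi -> ip phi (hop psi) = e * ip phi psi) ->
  (forall A : {set site L}, #|A| = Ne -> ~~ conn tl hd A -> (bdry tl hd A)%:R <= c) ->
  e + c < 0 -> spin_defect (fun s r => E s r) Ne psi = 0.
Proof.
move=> L1; apply: (@spin_defect_ground_eq0 _ _ _ _ tl hd (@ip R L)).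
- exact: ipC.
- exact: ipDr.
- exact: ip_ge0.
- exact: ip_eq0.
- exact: ax_an.
- exact: cx_cx.
- exact: ax_cx.
- exact: ip_cx.
- by move=> *; apply: E_An.
- by move=> *; apply: E_Cr.
- by move=> *; apply: ip_E.
- exact: flat_space_B.
- exact: flat_space_cxax.
- exact: flat_space_E.
- exact: E_numMn.
- by move=> s r u [h _]; apply: E_hop.
- by move=> b; apply: tl_neq_hd.
Qed.

Lemma hop_sym phi psi : ip phi (hop psi) = ip psi (hop phi).
Proof. exact: (ip_hopping_sym tl hd (@ipC R L) (@ipDr R L) ip_cx). Qed.

Lemma hopP (c : C) phi psi : hop (c *: phi + psi) = c *: hop phi + hop psi.
Proof. exact: hop_linear. Qed.

Lemma adm_lin (c : C) phi psi : adm phi -> adm psi -> adm (c *: phi + psi).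
Proof.
move=> [[h1 h2] h3] [[h4 h5] h6]; split.
  by split; [apply: flat_bandD => //; apply: flat_bandZ|apply: n_electron_lin].
move=> x y xy; by rewrite singlet_linear h3 // h6 // scaler0 addr0.
Qed.

Lemma adm_trial (t0 : (1 < L)%N) (n : nat) : (2 * n <= L)%N -> (n + Ne = #|{: site L}|)%N ->
  exists psi, [/\ adm psi, ip psi psi = 1
    & (4 <= n)%N -> ip psi (hop psi) < 10 - 6 * n%:R].
Proof.
move=> nL nNe; have L0 : (0 < L)%N := ltnW t0.
have [p [S [pL cS hS]]] := hole_momenta R L0 nL.
have P0 m : flat_space m 0 by split; [apply: flat_band0|apply: n_electron0].
have PZ m a u : flat_space m u -> flat_space m (a *: u) by move=> [h1 h2]; split; [apply: flat_bandZ|apply: n_electronZ].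
have PD m u v : flat_space m u -> flat_space m v -> flat_space m (u + v).
  by move=> [h1 h2] [h3 h4]; split; [apply: flat_bandD|apply: n_electronD].
have P_an m x s u : flat_space m u -> flat_space m.-1 (ax x s u).
  by move=> [h1 h2]; split; [apply: flat_band_ax|apply: n_electron_An].
have P_cr m x s u : flat_space m u -> flat_space m.+1 (cx x s u).
  by move=> [h1 h2]; split; [apply: flat_band_cx|apply: n_electron_Cr].
have orth j k := wave_orthonormal R L0 j k pL.
have blo k := wave_bloch R L0 k pL.
have [psi [Ppsi n1 a0 hE]] := @trial_state R L o V (@ip R L) (@ipC R L) (@ipDr R L)
  (fun u a v => ipZr u a v) (fun u a v => ipJ u a v) ax cx ax_an cx_cx ax_cx cx2_0 ip_cx flat_space
  P0 PZ PD P_an P_cr vac (fun x s => An_vac (aF x) s) flat_space_vac ip_vac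
  (fun b => tl_neq_hd o b t0) _ (@wave R L p) (@wave_energy R L p) orth blo S.
exists psi; split => //.
  apply: double_free_admissible; first by move: Ppsi; rewrite cS -nNe addnC addnK.
  (* There are no down electrons: this is known for the modes [a_x], hence for lattice sites, and
     the flat-band relations carry it to the auxiliary sites. *)
  move=> z; have kb := Ppsi.1.
  have an0 x : ann (inl x, false) psi = 0.
    have := a0 x; rewrite ax_ann // => /eqP; rewrite scaler_eq0 => /orP[|/eqP//].
    by move=> /eqP/(congr1 (@complex.Re R)) /= h; have := anorm_gt0 mu; rewrite h ltxx.
  rewrite (_ : ann (z, false) psi = 0) ?linear0 //.
  case: z => [x|[b|b]]; first exact: an0.
    by rewrite -/(usite b) ann_u // !an0 addr0 scaler0.
  by rewrite -/(ubsite b) ann_ub // !an0 subr0 scaler0.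
by move=> n4; rewrite /hop hE; have := hS n4; lra.
Qed.

End Model.

(** * The iterated limit of an affine energy *)

Section Limits.
Variable R : realType.
Local Open Scope ereal_scope.

Lemma affine_cvgy (a d : R) : (0 < d)%R -> (a + U * d)%:E @[U --> +oo%R] --> +oo.
Proof.
move=> d0; apply/cvgeryP; apply/cvgryPge => A; exists ((A - a) / d)%R.
split; first exact: num_real.
move=> U; rewrite ltr_pdivrMr //; lra.
Qed.

(** A positive [d] forces the inner limit to be infinite at every [s], hence the outer one too; once
    [d] is 0, a positive [b] does the same. *)
Lemma iterated_limit_affine (a b d : R) (g : R -> \bar R) (e : \bar R) :
  (0 <= b)%R -> (0 <= d)%R ->
  (forall s : R, (a + s * b + U * d)%:E @[U --> +oo%R] --> g s) ->
  g s @[s --> +oo%R] --> e -> e < +oo -> [/\ b = 0%R, d = 0%R & e = a%:E].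
Proof.
move=> b0 d0 hg he efin.
have uniq (f : R -> \bar R) (l l' : \bar R) : f s @[s --> +oo%R] --> l -> f s @[s --> +oo%R] --> l' -> l = l'.
  by move=> h h'; exact: (cvg_unique (@ereal_hausdorff R) h h').
have nolim : ~ (g s @[s --> +oo%R] --> +oo).
  by move=> h; move: efin; rewrite (uniq _ _ _ he h) ltxx.
have dE : d = 0%R.
  move: d0; rewrite le_eqVlt => /orP[/eqP//|d0]; exfalso; apply: nolim.
  have -> : g = fun=> +oo.
    apply/funext => s; apply: (uniq _ _ _ (hg s)); exact: affine_cvgy.
  exact: cvg_cst.
have gE : g = fun s => (a + s * b)%:E.
  apply/funext => s; apply: (uniq _ _ _ (hg s)); rewrite dE.
  have -> : (fun U : R => (a + s * b + U * 0)%:E) = fun=> (a + s * b)%:E.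
    by apply/funext => U; rewrite mulr0 addr0.
  exact: cvg_cst.
have bE : b = 0%R.
  move: b0; rewrite le_eqVlt => /orP[/eqP//|b0]; exfalso; apply: nolim.
  by rewrite gE; exact: affine_cvgy.
split=> //; apply: (uniq _ _ _ he); rewrite gE bE.
have -> : (fun s : R => (a + s * 0)%:E) = fun=> a%:E.
  by apply/funext => U; rewrite mulr0 addr0.
exact: cvg_cst.
Qed.

End Limits.

Lemma scale_half_quarter (R : realType) (V : lmodType R[i]) (u v : V) :
  2%:R^-1 *: u + 4%:R^-1 *: v = 4%:R^-1 *: (u *+ 2 + v).
Proof.
have -> : u *+ 2 = (2%:R : R[i]) *: u by rewrite scaler_nat.
rewrite scalerDr scalerA; congr (_ *: _ + _).
by rewrite -[4%N]/(2 * 2)%N natrM invfM divfK ?pnatr_eq0.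
Qed.

Lemma scale_quarter_natmul (R : realType) (V : lmodType R[i]) (n : nat) (v : V) :
  4%:R^-1 *: (v *+ (n * (n + 2))) = ((n%:R / 2%:R) * (n%:R / 2%:R + 1))%:C *: v.
Proof.
have -> : v *+ (n * (n + 2)) = ((n * (n + 2))%:R : R[i]) *: v by rewrite scaler_nat.
rewrite scalerA; congr (_ *: _).
have -> : (n%:R / 2%:R) * (n%:R / 2%:R + 1) = 4%:R^-1 * (n * (n + 2))%:R :> R.
  by rewrite natrM natrD; field.
rewrite (rmorphM (real_complex R)) (fmorphV (real_complex R)).
by rewrite !(rmorph_nat (real_complex R)).
Qed.

Lemma spin_defect_Stot_sq (R : realType) (L Ne : nat) (phi : fock R L) :
  spin_defect (fun s r => E s r) Ne phi = 0 ->
  Stot_sq phi = ((Ne%:R / 2%:R) * (Ne%:R / 2%:R + 1))%:C *: phi.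
Proof.
move=> /eqP; rewrite subr_eq0 => /eqP h.
by rewrite Stot_sqE scale_half_quarter -/(S4 (fun s r => E s r) phi) -h scale_quarter_natmul.
Qed.

(* Polarisation: the quadratic form vanishes at [r = 0] and is nonnegative on the line. *)
Lemma quadratic_polar (R : realFieldType) (e qpp qpf hpp hpf : R) : e * qpp <= hpp ->
  (forall r, e * (r * (r * qpp) + r * qpf + (r * qpf + 1)) <=
             r * (r * hpp) + r * hpf + (r * hpf + e)) -> hpf = e * qpf.
Proof.
move=> h0 h; pose be := hpf - e * qpf; pose ga := hpp - e * qpp.
have ga0 : 0 <= ga by rewrite subr_ge0.
have g1 : 0 < ga + 1 by lra.
have q r : 0 <= 2 * r * be + r ^+ 2 * ga by have := h r; rewrite /be /ga; lra.
(* The minimizer of the quadratic would be - be / ga; the added 1 keeps the denominator positive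
   when ga is 0. *)
apply/eqP; rewrite -subr_eq0 -/be; have := q (- be / (ga + 1)).
have -> : 2 * (- be / (ga + 1)) * be + (- be / (ga + 1)) ^+ 2 * ga
   = - (be ^+ 2 * ((ga + 2) / (ga + 1) ^+ 2)).
  by field; rewrite gt_eqF.
rewrite oppr_ge0 => h'; rewrite -sqrf_eq0 eq_le sqr_ge0 andbT.
by move: h'; rewrite pmulr_lle0 // divr_gt0 ?exprn_gt0 //; lra.
Qed.

(** * Ground states: constraints and variational equation *)

Section GroundState.
Variables (R : realType) (L : nat) (o : bond L -> bool) (mu t : R) (Ne : nat).
Hypotheses (mu0 : 0 < mu) (t0 : 0 < t).
Local Notation tl := (btail o).
Local Notation hd := (bhead o).
Local Notation V := (fock R L).
Local Notation hop := (@hop R L o mu).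
Local Notation adm := (admissible tl hd (fun x s => ax o mu x s) (flat_space o mu Ne)).

Lemma flat_defect_ge0 (psi : V) : 0 <= flat_defect o mu psi.
Proof. by apply: sumr_ge0 => b _; apply: sumr_ge0 => s _; rewrite addr_ge0 // ip_ge0. Qed.
Lemma double_occ_ge0 (psi : V) : 0 <= double_occ psi.
Proof. by apply: sumr_ge0 => z _; rewrite ip_ge0. Qed.

Lemma limit_energy_adm psi : adm psi -> limit_energy o mu t psi (t * ip psi (hop psi))%:E.
Proof.
move=> h; have kb := h.1.1.
have nb0 : flat_defect o mu psi = 0.
  rewrite /flat_defect big1 // => b _; rewrite big1 // => s _; have [-> ->] := kb s b.
  by rewrite ip0r addr0.
have nd0 : double_occ psi = 0.
  by rewrite /double_occ big1 // => z _; rewrite (admissible_double_free h) ip0r.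
exists (fun=> (t * ip psi (hop psi))%:E); split; last exact: cvg_cst.
move=> s; have -> : (fun U : R => (energy o mu t s U psi)%:E) = fun=> (t * ip psi (hop psi))%:E.
  by apply/funext => U; rewrite energyE nb0 nd0 !mulr0 !addr0.
exact: cvg_cst.
Qed.

Lemma limit_energy_finite psi e : n_electron Ne psi ->
  limit_energy o mu t psi e -> (e < +oo)%E -> adm psi /\ e = (t * ip psi (hop psi))%:E.
Proof.
move=> ne [g [hg he]] efin.
have hlim s : (t * ip psi (hop psi) + s * flat_defect o mu psi + U * double_occ psi)%:E @[U --> +oo] --> g s.
  have := hg s; have -> // : (fun U : R => (energy o mu t s U psi)%:E) =
     (fun U : R => (t * ip psi (hop psi) + s * flat_defect o mu psi + U * double_occ psi)%:E).
  by apply/funext => U; rewrite energyE.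
have [nb0 nd0 eE] := iterated_limit_affine (flat_defect_ge0 psi) (double_occ_ge0 psi) hlim he efin.
split=> //; apply: double_free_admissible => //.
  split=> // s b; move: nb0; rewrite /flat_defect => /eqP.
  rewrite psumr_eq0; last by move=> i _; apply: sumr_ge0 => q _; rewrite addr_ge0 // ip_ge0.
  move=> /allP/(_ b (mem_index_enum _)) /=.
  rewrite psumr_eq0; last by move=> q _; rewrite addr_ge0 // ip_ge0.
  move=> /allP/(_ s (mem_index_enum _)) /=.
  by rewrite paddr_eq0 ?ip_ge0 // => /andP[/eqP/ip_eq0 -> /eqP/ip_eq0 ->].
move=> z; move: nd0 => /eqP; rewrite psumr_eq0; last by move=> i _; rewrite ip_ge0.
by move=> /allP/(_ z (mem_index_enum _)) /= /eqP/ip_eq0.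
Qed.

(** The assumed admissible unit vector makes the minimal limiting energy finite, which forces the
    constraints on [phi]. Real variations give the real part of the eigenvalue equation, and [ip]
    sees nothing else. *)
Lemma ground_state_hop phi : ground_state o mu t Ne phi ->
  (exists2 psi, adm psi & ip psi psi = 1) ->
  let e := ip phi (hop phi) in
  [/\ adm phi, forall psi, adm psi -> e * ip psi psi <= ip psi (hop psi)
    & forall psi, adm psi -> ip psi (hop phi) = e * ip psi phi].
Proof.
move=> [ne [/normalizedP n1 [e0 [he0 emin]]]] [psi0 C0 n0] e.
have bound psi : adm psi -> ip psi psi = 1 -> (e0 <= (t * ip psi (hop psi))%:E)%E.
  move=> Cpsi n; apply: (emin psi) => //; [exact: Cpsi.1.2|exact/normalizedP|].
  exact: limit_energy_adm.
have [Cphi e0E] := limit_energy_finite ne he0 (le_lt_trans (bound _ C0 n0) (ltry _)).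
have hopP := @hopP R L o mu.
have hop0 : hop 0 = 0.
  by have := hopP (-1) 0 0; rewrite !scaleN1r !addNr.
have hopZ c psi : hop (c *: psi) = c *: hop psi.
  by have := hopP c psi 0; rewrite hop0 !addr0.
have zero : adm 0 by have := adm_lin (-1) Cphi Cphi; rewrite scaleN1r addNr.
have min psi : adm psi -> e * ip psi psi <= ip psi (hop psi).
  move=> Cpsi; have := ip_ge0 psi; rewrite le_eqVlt => /orP[/eqP/esym h|h].
    by rewrite h mulr0 (ip_eq0 h) hop0 ip0r.
  set r := (Num.sqrt (ip psi psi))^-1.
  have r2 : r ^+ 2 = (ip psi psi)^-1 by rewrite exprVn sqr_sqrtr // ltW.
  have Cr : adm (r%:C *: psi) by have := adm_lin r%:C Cpsi zero; rewrite addr0.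
  have nr : ip (r%:C *: psi) (r%:C *: psi) = 1.
    by rewrite ipZl ipZr mulrA -expr2 r2 mulVf ?gt_eqF.
  have := bound _ Cr nr; rewrite hopZ ipZl ipZr e0E lee_fin ler_pM2l // -/e.
  by rewrite mulrA -expr2 r2 mulrC ler_pdivlMr.
split=> // psi Cpsi.
have e1 r : ip (r%:C *: psi + phi) (r%:C *: psi + phi) =
    r * (r * ip psi psi) + r * ip psi phi + (r * ip psi phi + 1).
  by rewrite ipDl 2!ipDr 2!ipZl 2!ipZr (ipC phi psi) n1.
have e2 r : ip (r%:C *: psi + phi) (hop (r%:C *: psi + phi)) =
    r * (r * ip psi (hop psi)) + r * ip psi (hop phi) + (r * ip psi (hop phi) + e).
  have hs := hop_sym o mu phi psi; rewrite hopP /e; move: hs.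
  by move: (hop phi) (hop psi) => a b hs; rewrite ipDl 2!ipDr 2!ipZl 2!ipZr hs.
apply: quadratic_polar (min _ Cpsi) _ => r.
by have := min _ (adm_lin r%:C Cpsi Cphi); rewrite e1 e2.
Qed.

End GroundState.

Lemma boundary_bound (R : realType) (b m n : nat) :
  (b + 2 * m = 6 * n)%N -> (5 <= m)%N -> b%:R <= 6 * n%:R - 10 :> R.
Proof.
move=> h h5; have : (b + 10 <= 6 * n)%N by lia.
by rewrite -(ler_nat R) natrD natrM; lra.
Qed.

Lemma energy_gap (R : realType) (e h x : R) : e <= h -> h < 10 - x -> e + (x - 10) < 0.
Proof. lra. Qed.

Theorem theorem5 (R : realType) (L : nat) (o : bond L -> bool)
    (mu t : R) (Ne : nat) :
  (3 <= L)%N -> 0 < mu -> 0 < t ->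
  (Ne <= #|{: site L}|)%N ->
  (#|{: site L}|%:R - Num.sqrt (#|{: site L}|%:R) / 2%:R <= Ne%:R :> R) ->
  forall phi : fock R L,
    ground_state o mu t Ne phi ->
    Stot_sq phi = ((Ne%:R / 2%:R) * (Ne%:R / 2%:R + 1))%:C *: phi.
Proof.
move=> L3 mu0 t0 NeM hNe phi gs; have L1 : (1 < L)%N by apply: ltnW.
have cM : #|{: site L}| = (L * L)%N by rewrite card_prod card_ord.
have [n nNe] : exists n, (n + Ne = #|{: site L}|)%N.
  by exists (#|{: site L}| - Ne)%N; rewrite subnK.
(* As the lattice has L^2 sites, the square root in the hypothesis is L. *)
have nL : (2 * n <= L)%N.
  move: hNe; rewrite cM natrM -expr2 sqrtr_sqr ger0_norm // => hNe.
  have := congr1 (fun m => m%:R : R) nNe; rewrite /= cM natrD natrM => nE.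
  by rewrite -(ler_nat R) natrM; lra.
have [psi [Cpsi n1 hpsi]] := adm_trial o mu0 L1 nL nNe.
have [|Cphi hmin hvar] := ground_state_hop mu0 t0 gs; first by exists psi.
set e := ip phi _ in hmin hvar; apply: spin_defect_Stot_sq.
(* The trial energy estimate requires at least four holes, and this is supplied by the existence of
   a disconnected configuration. *)
have [/existsP[A /andP[/eqP cA ncA]]|/existsPn none] :=
  boolP [exists A : {set site L}, (#|A| == Ne) && ~~ conn (btail o) (bhead o) A].
  have cH (B : {set site L}) : #|B| = Ne -> #|~: B| = n by move=> cB; rewrite cardsCs finset.setCK -nNe cB addnK.
  have few : (n < L)%N by lia.
  have n4 : (4 <= n)%N.
    by have := disconnected_holes L3 _ ncA; rewrite cH // => /(_ few) /andP[].
  apply: (ground_spin_defect_eq0 (e := e) (c := 6 * n%:R - 10) L1 Cphi hvar).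
    move=> B cB ncB; have := disconnected_holes L3 _ ncB; rewrite cH // => /(_ few) /andP[_ h5].
    by apply: boundary_bound h5; rewrite -(cH B cB); apply: bdry_bonds.
  by have := hmin _ Cpsi; rewrite n1 mulr1 => /energy_gap; apply; apply: hpsi.
(* With all configurations connected the boundary bound is vacuous, so [c] is chosen freely to make
   e + c = -1. *)
apply: (ground_spin_defect_eq0 (e := e) (c := - e - 1) L1 Cphi hvar); last first.
  by rewrite addrA subrr sub0r oppr_lt0.
by move=> B cB ncB; have := none B; rewrite cB eqxx ncB.
Qed.
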